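(* Let $f\in L^2(\mathbb T^d)$. There exists a unique weak solution $u\in H_{1,W}(\mathbb T^d)$ of the equation $$\lambda u-\nabla A\nabla_Wu=f,\qquad\lambda>0.$$ This solution enjoys the bounds $$\|u\|_{1,W}\le C\|f\|_{L^2(\mathbb T^d)}$$ for some constant $C>0$ independent of $f$, and $$\|u\|_{L^2(\mathbb T^d)}\le\lambda^{-1}\|f\|_{L^2(\mathbb T^d)}.$$
   Context: $\mathbb T=\mathbb R/\mathbb Z=[0,1)$ and $\mathbb T^d=[0,1)^d$. $W(x)=\sum_{k=1}^dW_k(x_k)$, where each $W_k:\mathbb R\to\mathbb R$ is strictly increasing, right continuous with left limits, and satisfies $W_k(u+1)-W_k(u)=W_k(1)-W_k(0)$ for all $u$. $dW_k$ is the measure induced by $W_k$ on $\mathbb T$. The generalized derivative is $\partial_{W_k}f(x)=\lim_{\epsilon\to0}\frac{f(x+\epsilon e_k)-f(x)}{W_k(x_k+\epsilon)-W_k(x_k)}$ when the limit exists and is finite. One-dimensional operator: $\mathcal D_{W_k}$ is the set of $f\in L^2(\mathbb T)$ of the form $f(x)=a+bW_k(x)+\int_{(0,x]}W_k(dy)\int_0^y\mathfrak f(z)\,dz$ with $\mathfrak f\in L^2(\mathbb T)$, $\int_0^1\mathfrak f(z)\,dz=0$ and $\int_{(0,1]}W_k(dy)\{b+\int_0^y\mathfrak f(z)\,dz\}=0$; on $\mathcal D_{W_k}$, $\mathcal L_{W_k}f=\partial_{x_k}\partial_{W_k}f$ (with $\partial_{W_k}f(x)=b+\int_0^x\mathfrak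 f(z)\,dz$ and $\mathcal L_{W_k}f=\mathfrak f$). $\mathcal A_{W_k}$ is a countable complete orthonormal system of $L^2(\mathbb T)$ consisting of eigenvectors of $\mathcal L_{W_k}$. $\mathcal A_W=\{f:\ f(x)=\prod_{k=1}^df_k(x_k),\ f_k\in\mathcal A_{W_k}\}$ and $\mathbb D_W=\mathrm{span}(\mathcal A_W)$. For $f\in\mathbb D_W$, $\partial_{W_i}f$ and $\partial_{x_i}\partial_{W_i}f$ act on the $i$th coordinate with the others fixed. $d(x^i\otimes W_i)=dx_1\cdots dx_{i-1}\,dW_i\,dx_{i+1}\cdots dx_d$ on $\mathbb T^d$; $L^2_{x^i\otimes W_i}(\mathbb T^d)$ is the corresponding $L^2$ space, and $L^2_{x^i\otimes W_i,0}(\mathbb T^d)$ is its closed subspace of functions $f$ with zero mean, $\int_{\mathbb T^d}f\,d(x^i\otimes W_i)=0$. The $W$-Sobolev space $H_{1,W}(\mathbb T^d)$ is the set of $g\in L^2(\mathbb T^d)$ such that for each $i=1,\dots,d$ there is $G_i\in L^2_{x^i\otimes W_i,0}(\mathbb T^d)$ with $\int_{\mathbb T^d}(\partial_{x_i}\partial_{W_i}f)\,g\,dx=-\int_{\mathbb T^d}(\partial_{W_i}f)\,G_i\,d(x^i\otimes W_i)$ for all $f\in\mathbb D_W$; the (unique) $G_i$ is denoted $\partial_{W_i}g$. Its norm $\|\cdot\|_{1,W}$ is induced by $\langle f,g\rangle_{1,W}=\int_{\mathbb T^d}fg\,dx+\sum_{i=1}^d\int_{\mathbb T^d}(\partial_{W_i}f)(\partial_{W_i}g)\,d(x^i\otimes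 W_i)$. $A(x)=\mathrm{diag}(a_1(x),\dots,a_d(x))$, $x\in\mathbb T^d$, is a diagonal matrix function for which there is a constant $\theta>0$ with $\theta^{-1}\le a_i(x)\le\theta$ for all $x$ and $i$. $\nabla A\nabla_Wu:=\sum_{i=1}^d\partial_{x_i}(a_i\partial_{W_i}u)$. A function $u\in H_{1,W}(\mathbb T^d)$ is a weak solution of $\lambda u-\nabla A\nabla_Wu=f$ if $\lambda\int_{\mathbb T^d}uv\,dx+\sum_{i=1}^d\int_{\mathbb T^d}a_i(\partial_{W_i}u)(\partial_{W_i}v)\,d(x^i\otimes W_i)=\int_{\mathbb T^d}fv\,dx$ for all $v\in H_{1,W}(\mathbb T^d)$.
   Formalization: For d≥2 the G_i in the definition of the W-Sobolev space is not unique (one may add a zero-mean function independent of x_i), so ∂_{W_i}g is taken to be the G_i lying in the L²-closure of {∂_{W_i}f : f∈D_W}; the a_i are assumed measurable. *)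

(* Defs.v *)
From HB Require Import structures.
From mathcomp Require Import all_boot all_order all_algebra.
From mathcomp Require Import all_classical all_reals all_analysis.

Set Implicit Arguments.
Unset Strict Implicit.
Unset Printing Implicit Defensive.
Import Order.TTheory GRing.Theory Num.Theory.
Import numFieldNormedType.Exports.

Local Open Scope classical_set_scope.
Local Open Scope ring_scope.

(** The torus [T = R/Z] is represented by its fundamental domain [0, 1):
    measures on [T] are measures on [R] restricted to [`[0, 1[], and (classes
    of) functions on [T^d] are functions on [d.-tuple R], of which only the
    values on [0, 1)^d matter.  Functions that are differentiated pointwise
    are taken 1-periodic, so that difference quotients make sense across the
    endpoint. *)

Section CircleMeasure.
Context {R : realType}.

(** [W (u + 1) - W u = W 1 - W 0] gives the mass [W 1 - W (1-)] of the point 1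
    of ]0, 1] to the point 0 of [0, 1[, so this is the measure induced by [W]
    on [R/Z]. *)
Definition circle_measure (W : cumulative R R) :
    set (measurableTypeR R) -> \bar R :=
  mrestr (lebesgue_stieltjes_measure W) (measurable_itv `[0%R, 1%R[).

HB.instance Definition _ (W : cumulative R R) :=
  Measure.on (circle_measure W).

Let circle_measure_fin (W : cumulative R R) : fin_num_fun (circle_measure W).
Proof.
apply: lty_fin_num_fun => /=; rewrite /circle_measure /mrestr setTI.
apply: (@le_lt_trans _ _ (lebesgue_stieltjes_measure W `]-1, 1]%classic)).
  apply: le_measure; rewrite ?inE; [exact: measurable_itv.. |].
  by apply: subset_itv; rewrite bnd_simp// ltrN10.
rewrite /lebesgue_stieltjes_measure /measure_extension/=.
rewrite measurable_mu_extE/=; last exact: is_ocitv.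
by rewrite wlength_itv_bnd ?ltry// (le_trans (lerN10 _))// ler01.
Qed.

HB.instance Definition _ (W : cumulative R R) :=
  Measure_isFinite.Build _ _ _ (circle_measure W) (circle_measure_fin W).

End CircleMeasure.

Section ProductMeasure.
Context {R : realType} d (T : measurableType d).

Definition tuple_consp n (p : T * n.-tuple T) : n.+1.-tuple T :=
  [the n.+1.-tuple T of p.1 :: p.2].

Lemma measurable_tuple_consp n : measurable_fun setT (@tuple_consp n).
Proof. exact: measurable_cons. Qed.

Section Step.
Variables (n : nat) (m1 : {finite_measure set T -> \bar R})
  (m2 : {finite_measure set (n.-tuple T) -> \bar R}).

Definition cons_measure : set (n.+1.-tuple T) -> \bar R :=
  pushforward (m1 \x m2)%E (@tuple_consp n).

Let cons_measure0 : cons_measure set0 = 0%E.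
Proof. by rewrite /cons_measure /pushforward preimage_set0 measure0. Qed.

Let cons_measure_ge0 A : (0 <= cons_measure A)%E.
Proof. by rewrite /cons_measure /pushforward; exact: measure_ge0. Qed.

Let cons_measure_sigma_additive : semi_sigma_additive cons_measure.
Proof.
have mc (A : set (n.+1.-tuple T)) :
    measurable A -> measurable (@tuple_consp n @^-1` A).
  move=> mA; rewrite -[X in measurable X]setTI.
  exact: measurable_tuple_consp.
move=> F mF tF mUF; rewrite /cons_measure /pushforward preimage_bigcup.
apply: measure_semi_sigma_additive.
- by move=> k; exact: mc.
- apply/trivIsetP => /= i j _ _ ij; rewrite -preimage_setI.
  by move/trivIsetP : tF => /(_ _ _ _ _ ij) ->//; rewrite preimage_set0.
- by rewrite -preimage_bigcup; exact: mc.
Qed.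

HB.instance Definition _ := isMeasure.Build _ _ _ cons_measure
  cons_measure0 cons_measure_ge0 cons_measure_sigma_additive.

Let cons_measure_fin : fin_num_fun cons_measure.
Proof.
apply: lty_fin_num_fun => /=.
rewrite /cons_measure /pushforward preimage_setT -setXTT.
rewrite product_measure1E//.
by rewrite lte_mul_pinfty// ?fin_num_measure// -ge0_fin_numE// fin_num_measure.
Qed.

HB.instance Definition _ :=
  Measure_isFinite.Build _ _ _ cons_measure cons_measure_fin.

End Step.

Fixpoint prod_measure n :
    ('I_n -> {finite_measure set T -> \bar R}) ->
    {finite_measure set (n.-tuple T) -> \bar R} :=
  match n with
  | 0 => fun=> \d_ [tuple]
  | n'.+1 => fun m =>
      cons_measure (m ord0) (prod_measure (fun k => m (lift ord0 k)))
  end.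

End ProductMeasure.

Lemma prod_measureE {R : realType} d (T : measurableType d) n
    (m : 'I_n -> {finite_measure set T -> \bar R}) (A : 'I_n -> set T) :
  (forall k, measurable (A k)) ->
  prod_measure m [set x | forall k, A k (tnth x k)] =
    (\prod_(k < n) m k (A k))%E.
Proof.
elim: n m A => [|n IH] m A mA /=.
  by rewrite big_ord0 diracE mem_set// => -[].
pose B := [set x : n.-tuple T | forall k, A (lift ord0 k) (tnth x k)].
have mB : measurable B.
  rewrite (_ : B = \bigcap_(k in [set: 'I_n])
      ((fun x : n.-tuple T => tnth x k) @^-1` A (lift ord0 k))).
    apply: fin_bigcap_measurable => // k _.
    by rewrite -[X in measurable X]setTI; exact: measurable_tnth.
  by apply/seteqP; split=> x xB k; [move=> _; exact: xB|exact: (xB k I)].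
rewrite big_ord_recl -IH// -product_measure1E//.
rewrite /cons_measure /pushforward; congr product_measure1.
apply/seteqP; split=> -[x y] /=.
  move=> Axy; split; first exact: (Axy ord0).
  by move=> k; have := Axy (lift ord0 k); rewrite tnthS.
move=> [Ax By] k; have [->//|k0] := eqVneq k ord0.
case: (unliftP ord0 k) k0 => [j -> _|-> /eqP//]; rewrite tnthS; exact: By.
Qed.

Section OneDim.
Context {R : realType}.
Implicit Types (W : cumulative R R) (f g : R -> R).

Notation lebT := (circle_measure (idfun : cumulative R R)).

(** Only used for 1-periodic [f]; both increments are then those of [R/Z]. *)
Definition gen_derive W f (x : R) : R :=
  lim ((f (x + e) - f x) / (W (x + e) - W x) @[e --> 0^']).

(** The graph of [L_W = d/dx d/dW]: [LW_graph W f g] means that [f] is in its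
    domain and that [L_W f = g] as an element of [L^2(T)].  Of the class of [f]
    in [L^2(T)] only the representative for which the integral formula holds
    everywhere is retained: it is the one that has a [W]-derivative. *)
Definition LW_graph W f g : Prop :=
  [/\ f \in Lfun lebT 2%:E, periodic f 1, g \in Lfun lebT 2%:E,
      \int[lebesgue_measure]_(z in `[0, 1]) g z = 0 &
      exists a b : R,
        let F y := b + \int[lebesgue_measure]_(z in `[0, y]) g z in
        \int[lebesgue_stieltjes_measure W]_(y in `]0, 1]) F y = 0 /\
        forall x, x \in `[0, 1[ ->
          f x = a + b * W x +
            \int[lebesgue_stieltjes_measure W]_(y in `]0, x])
              \int[lebesgue_measure]_(z in `[0, y]) g z].

(** The last clause is completeness: only 0 is orthogonal to the system. *)
Definition eigenbasis W (A : set (R -> R)) : Prop :=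
  [/\ countable A,
      forall f, A f -> exists mu : R, LW_graph W f (fun x => mu * f x),
      forall f, A f -> \int[lebT]_x (f x * f x) = 1,
      forall f g, A f -> A g -> f <> g -> \int[lebT]_x (f x * g x) = 0 &
      forall g, g \in Lfun lebT 2%:E ->
        (forall f, A f -> \int[lebT]_x (f x * g x) = 0) ->
        g = cst 0 %[ae lebT]].

End OneDim.

Section WSobolev.
Context {R : realType} (d : nat).
Variables (W : 'I_d -> cumulative R R) (A : 'I_d -> set (R -> R)).

Notation Td := (d.-tuple (measurableTypeR R)).
Implicit Types (f g u v : Td -> R) (i k : 'I_d) (x : Td).

Definition lebTd : {finite_measure set Td -> \bar R} :=
  prod_measure (fun=> circle_measure (idfun : cumulative R R)).

(** [d(x^i (x) W_i)] *)
Definition xW i : {finite_measure set Td -> \bar R} :=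
  prod_measure (fun k =>
    circle_measure (if k == i then W k else (idfun : cumulative R R))).

Definition set_coord x i (t : R) : Td :=
  [tuple (if k == i then t else tnth x k) | k < d].

Definition partialW i f x : R :=
  gen_derive (W i) (fun t => f (set_coord x i t)) (tnth x i).

(** For [f] in [DW], [partialW i f] is absolutely continuous in the [i]-th
    coordinate, hence the pointwise derivative exists almost everywhere and
    coincides there with [L_{W_i} f] taken in that coordinate. *)
Definition partialxW i f x : R :=
  derive1 (fun t => partialW i f (set_coord x i t)) (tnth x i).

Definition AW : set (Td -> R) :=
  [set f | exists2 e : 'I_d -> R -> R, (forall k, A k (e k)) &
           forall x, f x = \prod_(k < d) e k (tnth x k)].

Definition DW : set (Td -> R) :=
  [set f | exists n (c : 'I_n -> R) (e : 'I_n -> Td -> R),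
           (forall m, AW (e m)) /\ forall x, f x = \sum_(m < n) c m * e m x].

Definition L20 i : set (Td -> R) :=
  [set G | G \in Lfun (xW i) 2%:E /\ \int[xW i]_x G x = 0].

(** When [d >= 2] these conditions do not determine [G]: adding to [G] a function
    of zero mean that does not depend on the [i]-th coordinate preserves both
    of them, since [partialW i f] integrates to 0 along that coordinate. *)
Definition weak_partialW i g G : Prop :=
  G \in L20 i /\
  forall f, DW f -> \int[lebTd]_x (partialxW i f x * g x) =
                  - \int[xW i]_x (partialW i f x * G x).

Definition H1W : set (Td -> R) :=
  [set g | g \in Lfun lebTd 2%:E /\ forall i, exists G, weak_partialW i g G].

Definition in_closure_partialW i G : Prop :=
  forall eps : R, 0 < eps ->
    exists2 f, DW f & ('N[xW i]_2%:E[EFin \o (G \- partialW i f)%R] < eps%:E)%E.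

(** The weak derivative of [g] is therefore the [G] above that lies in the
    closure of [partialW i] on [DW] in [L^2(xW i)].  It exists as soon as some
    [G] does (project [G] on this closed subspace of [L20 i]), it is unique
    almost everywhere, and it extends [partialW i] from [DW].  When [d = 1] the
    closure is all of [L20 i] and the condition is void. *)
Definition partialH i g : Td -> R :=
  xget (cst 0) [set G | weak_partialW i g G /\ in_closure_partialW i G].

Definition inner1W f g : R :=
  \int[lebTd]_x (f x * g x) +
  \sum_(i < d) \int[xW i]_x (partialH i f x * partialH i g x).

Definition norm1W g : R := Num.sqrt (inner1W g g).

Definition weak_solution (lambda : R) (a : 'I_d -> Td -> R) f u : Prop :=
  H1W u /\ forall v, H1W v ->
    lambda * \int[lebTd]_x (u x * v x) +
      \sum_(i < d) \int[xW i]_x (a i x * partialH i u x * partialH i v x) =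
    \int[lebTd]_x (f x * v x).

End WSobolev.

(* Main.v *)
(** For a test function [f] the [W_i]-derivative exists everywhere, is bounded
    and has zero mean, and [d/dx_i d/dW_i f] coincides almost everywhere with a
    bounded function [L].  Hence the weak identity reads [<L, g> = - <d_Wi f, G>]
    with all four functions in [L^2], so it is linear and closed in [(g, G)], and
    replacing [G] by its projection on the closure of the [d_Wi f] preserves it
    and makes [G] unique.  The pairs [(g, (G_i)_i)] thus form a Hilbert space for
    the energy [lambda <g, g'> + sum_i <a_i G_i, G'_i>], which is symmetric since
    the matrix is diagonal, and the solution is the Riesz representative of
    [v |-> <f, v>].  The bounds follow from testing the equation with [v = u]. *)

Require Import Defs.
From mathcomp Require Import all_boot all_order all_algebra.
From mathcomp Require Import all_classical all_reals all_analysis.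
From mathcomp Require Import measurable_realfun ring lra.
Import Order.TTheory GRing.Theory Num.Theory.
Import numFieldNormedType.Exports.

Set Implicit Arguments.
Unset Strict Implicit.
Unset Printing Implicit Defensive.

Local Open Scope classical_set_scope.
Local Open Scope ring_scope.

(** Functions are never quotiented by almost-everywhere equality, so the forms below are only
    semi-definite, and limits and representatives are fixed up to null sets. One Riesz lemma for
    such forms serves twice: on the closure of the test derivatives, where it gives the projection,
    and on the pairs [(g, G)], where it gives the solution. The claims on test functions need a
    one-dimensional bootstrap: an eigenfunction is a [W]-integral of a bounded function, hence
    bounded, so its [W]-derivative is Lipschitz on [0, 1]. The two constraints in [LW_graph] handle
    the wrap at 0: the vanishing integral of the density makes the one-sided [W]-derivatives agree
    there, and the vanishing [W]-integral gives the [W]-derivative zero mean. Since [partialxW] is a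
    pointwise limit, its values on the exceptional null set are uncontrolled; this is why integrals
    are compared off null sets without measurability. *)

(** * Riesz representation for a complete semi-definite form *)

Section Riesz.
Context {R : realType} {V : lmodType R}.
Implicit Types (S : set V) (B : V -> V -> R) (l : V -> R).

(* [B] need be bilinear only on [S] and may be degenerate, so that [S] can
   consist of square-integrable functions instead of their classes; [4^-1 ^+ n]
   is the Cauchy rate of any minimizing sequence, once thinned. *)
Record semi_hilbert_on S B : Prop := {
  sh0 : S 0 ;
  shP : forall a u v, S u -> S v -> S (a *: u + v) ;
  sh_sym : forall u v, S u -> S v -> B u v = B v u ;
  sh_lin : forall a u v w, S u -> S v -> S w ->
    B (a *: u + v) w = a * B u w + B v w ;
  sh_ge0 : forall u, S u -> 0 <= B u u ;
  sh_complete : forall u : nat -> V, (forall n, S (u n)) ->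
    (forall n, B (u n.+1 - u n) (u n.+1 - u n) <= 4^-1 ^+ n) ->
    exists2 x, S x & B (u n - x) (u n - x) @[n --> \oo] --> 0 }.

Section theory.
Variables (S : set V) (B : V -> V -> R).
Hypothesis SB : semi_hilbert_on S B.

Lemma shZ a u : S u -> S (a *: u).
Proof. by move=> Su; rewrite -[a *: u]addr0; apply: (shP SB) => //; exact: sh0 SB. Qed.

Lemma shB u v : S u -> S v -> S (u - v).
Proof. by move=> Su Sv; rewrite addrC -scaleN1r; exact: (shP SB). Qed.

Lemma sh_linr a u v w : S u -> S v -> S w ->
  B w (a *: u + v) = a * B w u + B w v.
Proof.
move=> Su Sv Sw; rewrite (sh_sym SB)//; last exact: (shP SB).
by rewrite (sh_lin SB)// !(sh_sym SB Sw).
Qed.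

Lemma sh_expand t u v : S u -> S v ->
  B (t *: v + u) (t *: v + u) = B u u + 2 * t * B u v + t ^+ 2 * B v v.
Proof.
move=> Su Sv; have Suv : S (t *: v + u) by exact: (shP SB).
by rewrite (sh_lin SB)// !sh_linr// (sh_sym SB Sv Su); ring.
Qed.

Lemma shBZ t v : S v -> B (t *: v) (t *: v) = t ^+ 2 * B v v.
Proof.
move=> Sv; have B0 w : S w -> B 0 w = 0.
  move=> Sw; have := sh_lin SB 1 (sh0 SB) (sh0 SB) Sw.
  by rewrite scaler0 addr0 mul1r; lra.
have := sh_expand t (sh0 SB) Sv.
by rewrite !addr0 !B0 ?mulr0 ?add0r//; exact: sh0 SB.
Qed.

Lemma sh_cauchy_schwarz u v : S u -> S v -> B u v ^+ 2 <= B u u * B v v.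
Proof.
move=> Su Sv.
have H t : 0 <= B u u + 2 * t * B u v + t ^+ 2 * B v v.
  by rewrite -sh_expand//; apply: (sh_ge0 SB); exact: (shP SB).
have [v0|v0] := eqVneq (B v v) 0.
  have [->|b0] := eqVneq (B u v) 0; first by rewrite expr0n/= mulr_ge0 ?(sh_ge0 SB).
  (* When [B v v = 0] the quadratic is affine in [t]; at this [t] it would equal -1. *)
  have := H (- (B u u + 1) / (2 * B u v)).
  rewrite v0 mulr0 addr0 [leRHS](_ : _ = - 1); last by field.
  by rewrite lerNr oppr0 ler10.
have vp : 0 < B v v by rewrite lt_neqAle eq_sym v0 (sh_ge0 SB).
(* The minimizer of the quadratic in [t]. *)
have := H (- B u v / B v v).
rewrite [leRHS](_ : _ = (B u u * B v v - B u v ^+ 2) / B v v); last by field.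
by rewrite pmulr_lge0 ?invr_gt0// subr_ge0.
Qed.

Lemma sh_cvg (u : nat -> V) x v : (forall n, S (u n)) -> S x -> S v ->
  B (u n - x) (u n - x) @[n --> \oo] --> 0 -> B (u n) v @[n --> \oo] --> B x v.
Proof.
move=> Su Sx Sv ux.
have Sux n : S (u n - x) by exact: shB.
suff h : B (u n - x) v @[n --> \oo] --> 0.
  rewrite (_ : (fun n => _) = (fun n => B (u n - x) v + B x v)); last first.
    by apply/funext => n; rewrite -[u n - x]addrC -scaleN1r (sh_lin SB)//; ring.
  by rewrite -[X in _ --> X]add0r; apply: cvgD => //; exact: cvg_cst.
apply/norm_cvg0P.
apply: (@squeeze_cvgr _ _ _ _ (cst 0) (fun n => Num.sqrt (B (u n - x) (u n - x) * B v v))).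
- near=> n; rewrite normr_ge0/= -sqrtr_sqr ler_wsqrtr//.
  exact: sh_cauchy_schwarz.
- exact: cvg_cst.
- have -> : 0 = Num.sqrt (0 * B v v) :> R by rewrite mul0r sqrtr0.
  apply: (cvg_comp (fun n => B (u n - x) (u n - x) * B v v) Num.sqrt).
    by apply: cvgM; [exact: ux|exact: cvg_cst].
  exact: sqrt_continuous.
Unshelve. all: by end_near. Qed.

(** Direct method: the representative is a limit of a sequence minimizing [J v = B v v - 2 l v]. The
    parallelogram identity makes that sequence Cauchy, and the first variation at the limit is the
    required identity. *)
Lemma riesz_on l C : 0 <= C ->
  (forall a u v, S u -> S v -> l (a *: u + v) = a * l u + l v) ->
  (forall v, S v -> l v ^+ 2 <= C * B v v) ->
  exists2 u, S u & forall v, S v -> B u v = l v.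
Proof.
move=> C0 ll lC.
pose J v := B v v - 2 * l v.
(* From [l v ^+ 2 <= C * B v v] and AM-GM, [2 * l v <= C + B v v]. *)
have JC v : S v -> - C <= J v.
  move=> Sv; have := lC v Sv; have := sh_ge0 SB Sv; rewrite /J.
  have := sqr_ge0 (C - B v v); nra.
have JSn0 : has_inf (J @` S).
  split; first by exists (J 0); exists 0 => //; exact: sh0 SB.
  by exists (- C) => _ [v Sv <-]; exact: JC.
pose m := inf (J @` S).
have Jm v : S v -> m <= J v.
  by move=> Sv; apply: ge_inf; [exact: JSn0.2|exists v].
(* The parallelogram identity turns the slacks of two consecutive terms into twice their sum, and 2
   (1/4 + 1/16) <= 1 leaves the rate [4^-1 ^+ n]. *)
have dn n : 0 < 4^-1 ^+ n / 4 :> R by rewrite divr_gt0// exprn_gt0.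
have ex n : exists v, S v /\ J v < m + 4^-1 ^+ n / 4.
  have [_ [v Sv <-] vm] := inf_adherent (dn n) JSn0.
  by exists v.
have [u uP] := choice ex.
have Su n : S (u n) by have [] := uP n.
(* Near-minimality of [u n] compared with [t *: v + u n]; letting [n] grow removes the slack for
   each fixed [t]. *)
have key n t v : S v -> - (4^-1 ^+ n / 4) <= 2 * t * (B (u n) v - l v) + t ^+ 2 * B v v.
  move=> Sv; have [_ un] := uP n.
  have := Jm _ (shP SB t Sv (Su n)); rewrite {1}/J sh_expand// ll//.
  by move: un; rewrite /J; lra.
have lZ t v : S v -> l (t *: v) = t * l v.
  move=> Sv; have l0 : l 0 = 0.
    by have := ll 1 0 0 (sh0 SB) (sh0 SB); rewrite scaler0 addr0 mul1r; lra.
  by have := ll t v 0 Sv (sh0 SB); rewrite addr0 l0 addr0.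
have par n : B (u n.+1 - u n) (u n.+1 - u n) <= 4^-1 ^+ n.
  have [_ u1] := uP n; have [_ u2] := uP n.+1.
  have Sw : S (1 *: u n.+1 + u n) by exact: (shP SB).
  have := Jm _ (shZ 2^-1 Sw); rewrite /J shBZ// lZ// sh_expand// ll//.
  have -> : u n.+1 - u n = (-1) *: u n + u n.+1 by rewrite scaleN1r addrC.
  rewrite sh_expand//.
  move: u1 u2; rewrite /J exprS.
  have := sh_sym SB (Su n) (Su n.+1) => ->.
  have : 0 < 4^-1 ^+ n :> R by rewrite exprn_gt0.
  by lra.
have [x Sx ux] := sh_complete SB Su par.
exists x => // v Sv.
have Bv := sh_cvg Su Sx Sv ux.
have lim t : 0 <= 2 * t * (B x v - l v) + t ^+ 2 * B v v.
  have c1 : - (4^-1 ^+ n / 4) @[n --> \oo] --> (0 : R).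
    rewrite -[X in _ --> X]oppr0; apply: cvgN; rewrite -[X in _ --> X](mul0r (4^-1)).
    apply: cvgM; last exact: cvg_cst.
    by apply: cvg_expr; rewrite ger0_norm ?invr_ge0// invf_lt1// ltr1n.
  have c2 : 2 * t * (B (u n) v - l v) + t ^+ 2 * B v v @[n --> \oo] -->
      2 * t * (B x v - l v) + t ^+ 2 * B v v.
    apply: cvgD; last exact: cvg_cst.
    apply: cvgM; first exact: cvg_cst.
    by apply: cvgB; [exact: Bv|exact: cvg_cst].
  by apply: (ler_cvg_to c1 c2); apply: nearW => n; exact: key.
have Bv0 := sh_ge0 SB Sv.
set D := B x v - l v in lim.
suff : D = 0 by rewrite /D; lra.
(* Close to the optimal [t]; the added 1 keeps the denominator positive when [B v v = 0], and the
   value is still negative unless [D = 0]. *)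
have := lim (- D / (B v v + 1)).
rewrite [leRHS](_ : _ = - (D ^+ 2) * ((B v v + 2) / (B v v + 1) ^+ 2)); last first.
  by field; lra.
rewrite pmulr_lge0; last by rewrite divr_gt0 ?exprn_gt0//; lra.
rewrite oppr_ge0 => D2.
by apply/eqP; rewrite -sqrf_eq0 eq_le D2 sqr_ge0.
Qed.

End theory.
End Riesz.

(** * Integrals compared off a null set, without measurability *)

Section NullModification.
Context d (T : measurableType d) (R : realType) (mu : {measure set T -> \bar R}).
Variables (N : set T) (mN : measurable N) (muN : mu N = 0%E).
Local Open Scope ereal_scope.

Import HBNNSimple.

(** The integral of any nonnegative function is a supremum over the simple functions below it.
    Cutting such a simple function to the complement of [N] keeps its integral and puts it below
    [g]. *)
Let le_integral_off_null (f g : T -> \bar R) :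
  (forall x, 0 <= f x) -> (forall x, 0 <= g x) ->
  (forall x, ~ N x -> f x = g x) -> \int[mu]_x f x <= \int[mu]_x g x.
Proof.
move=> f0 g0 fg; rewrite !ge0_integralTE//.
apply: ge_ereal_sup => _ [h /= hf <-].
have mNC : measurable (~` N) by exact: measurableC.
apply: (@le_trans _ _ (sintegral mu (proj_nnsfun h mNC))); last first.
  apply: ereal_sup_ubound; exists (proj_nnsfun h mNC) => //= x.
  rewrite /mindic indicE; have [xN|xN] := boolP (x \in ~` N).
    by rewrite mulr1 -fg//; exact: set_mem.
  by rewrite mulr0.
rewrite -!integralT_nnsfun (ge0_negligible_integral mN)//; last 2 first.
- exact/measurable_EFinP.
- by move=> x _; rewrite lee_fin.
rewrite [leRHS](ge0_negligible_integral mN)//; last 2 first.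
- exact/measurable_EFinP.
- by move=> x _; rewrite lee_fin.
rewrite le_eqVlt; apply/orP; left; apply/eqP; apply: eq_integral => x.
rewrite inE => -[_ Nx].
by rewrite /= /mindic indicE mem_set// mulr1.
Qed.

Let eq_ge0_integral_off_null (f g : T -> \bar R) :
  (forall x, 0 <= f x) -> (forall x, 0 <= g x) ->
  (forall x, ~ N x -> f x = g x) -> \int[mu]_x f x = \int[mu]_x g x.
Proof.
move=> f0 g0 fg; apply/eqP; rewrite eq_le !le_integral_off_null//.
by move=> x Nx; rewrite fg.
Qed.

(* Unlike in [ae_eq_integral], neither function has to be measurable. *)
Lemma eq_integral_off_null (f g : T -> \bar R) :
  (forall x, ~ N x -> f x = g x) -> \int[mu]_x f x = \int[mu]_x g x.
Proof.
move=> fg; rewrite integralE [RHS]integralE.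
by congr (_ - _); apply: eq_ge0_integral_off_null => // x Nx;
  rewrite ?funeposE ?funenegE fg.
Qed.

Lemma eq_Rintegral_off_null (f g : T -> R) :
  (forall x, ~ N x -> f x = g x) -> (\int[mu]_x f x = \int[mu]_x g x)%R.
Proof.
by move=> fg; congr fine; apply: eq_integral_off_null => x Nx; rewrite fg.
Qed.

End NullModification.

Lemma ae_eq_Rintegral d (T : measurableType d) (R : realType)
    (mu : {measure set T -> \bar R}) (f g : T -> R) :
  f = g %[ae mu] -> \int[mu]_x f x = \int[mu]_x g x.
Proof.
move=> [N [mN N0 fgN]]; apply: (eq_Rintegral_off_null mN N0) => x Nx.
by apply: contrapT => fg; apply/Nx/fgN => /= h; apply: fg; exact: h.
Qed.

(** * Square-integrable functions and their inner product *)

Section L2.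
Context d (T : measurableType d) (R : realType).
Variable mu : {measure set T -> \bar R}.
Implicit Types (f g h : T -> R).

Local Notation L2 := (Lfun mu 2%:E).
Local Notation "<< f , g >>" := (\int[mu]_x (f x * g x)).

Lemma Lfun2_measurable f : f \in L2 -> measurable_fun setT f.
Proof. by rewrite inE => /andP[+ _]; rewrite inE. Qed.

Lemma Lfun2_integrableM f g : f \in L2 -> g \in L2 ->
  mu.-integrable setT (EFin \o (fun x => f x * g x)).
Proof. by move=> fL gL; apply/Lfun1_integrable; exact: Lfun2_mul_Lfun1. Qed.

Lemma Lnorm2E f :
  ('N[mu]_2%:E[EFin \o f] = (\int[mu]_x (f x * f x)%:E) `^ 2^-1)%E.
Proof.
rewrite unlock; congr poweR; apply: eq_integral => x _ /=.
by rewrite powR_mulrn// -normrX expr2 ger0_norm// -expr2 sqr_ge0.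
Qed.

Lemma Lfun2P f : measurable_fun setT f ->
  (\int[mu]_x (f x * f x)%:E < +oo)%E -> f \in L2.
Proof.
move=> mf f2; rewrite inE; apply/andP; split; rewrite inE//=.
by rewrite /finite_norm Lnorm2E poweR_lty.
Qed.

Lemma Lfun2_Lnorm f : f \in L2 ->
  ('N[mu]_2%:E[EFin \o f] = (Num.sqrt <<f, f>>)%:E)%E.
Proof.
move=> fL; rewrite Lnorm2E.
have /(integrable_fin_num measurableT) : mu.-integrable setT
    (EFin \o (fun x => f x * f x)) by exact: Lfun2_integrableM.
by move=> /fineK <-; rewrite poweR_EFin powR12_sqrt// Rintegral_ge0// => x _;
  rewrite -expr2 sqr_ge0.
Qed.

Lemma Lfun2Z (a : R) f : f \in L2 -> a *: f \in L2.
Proof. by move=> fL; rewrite rpredZ// lee1n. Qed.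

Lemma Lfun2D f g : f \in L2 -> g \in L2 -> f + g \in L2.
Proof.
by move=> fL gL; have [_] := @Lfun_addr_closed _ _ _ mu 2%:E (lee1n 2); apply.
Qed.

Lemma Lfun2_linear (a : R) f g : f \in L2 -> g \in L2 -> a *: f + g \in L2.
Proof. by move=> fL gL; apply: Lfun2D => //; exact: Lfun2Z. Qed.

Lemma Lfun2B f g : f \in L2 -> g \in L2 -> f - g \in L2.
Proof. by move=> fL gL; rewrite addrC -scaleN1r Lfun2_linear. Qed.

Lemma Lfun2_0 : (0 : T -> R) \in L2.
Proof. by have [] := @Lfun_addr_closed _ _ _ mu 2%:E (lee1n 2). Qed.

Lemma Lfun2_bddM (b : T -> R) (M : R) f : measurable_fun setT b ->
  (forall x, `|b x| <= M) -> f \in L2 -> (fun x => b x * f x) \in L2.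
Proof.
move=> mb bM fL; have mf := Lfun2_measurable fL.
apply: Lfun2P; first exact: measurable_funM.
have i : mu.-integrable setT (fun x => (M ^+ 2)%:E * (f x * f x)%:E)%E.
  by apply: integrableZl => //; exact: Lfun2_integrableM.
have := integrable_lty measurableT i; apply: le_lt_trans.
apply: ge0_le_integral => //.
- by move=> x _; rewrite lee_fin -expr2 sqr_ge0.
- by apply/measurable_EFinP; do 3! apply: measurable_funM => //.
- by have /measurable_int := i.
- move=> x _; rewrite lee_fin mulrACA -!expr2 ler_wpM2r ?sqr_ge0//.
  by rewrite -[b x ^+ 2]real_normK ?num_real// lerXn2r ?nnegrE// (le_trans _ (bM x)).
Qed.

Lemma ip_lin (a : R) f g h : f \in L2 -> g \in L2 -> h \in L2 ->
  <<a *: f + g, h>> = a * <<f, h>> + <<g, h>>.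
Proof.
move=> fL gL hL; rewrite -RintegralZl//; last exact: Lfun2_integrableM.
rewrite -RintegralD//; last 2 first.
- have -> : EFin \o (fun x => a * (f x * h x)) =
    EFin \o (fun x => (a *: f : T -> R) x * h x) by apply/funext => x /=; rewrite mulrA.
  by apply: Lfun2_integrableM => //; exact: Lfun2Z.
- exact: Lfun2_integrableM.
by apply: eq_Rintegral => x _; rewrite /= mulrDl -[(a *: f) x]/(a * f x) mulrA.
Qed.

Lemma ip_sym f g : <<f, g>> = <<g, f>>.
Proof. by apply: eq_Rintegral => x _; rewrite mulrC. Qed.

Lemma ip_ge0 f : 0 <= <<f, f>>.
Proof. by apply: Rintegral_ge0 => x _; rewrite -expr2 sqr_ge0. Qed.

Lemma ip_eq0_ae f : f \in L2 -> <<f, f>> = 0 -> f = 0 %[ae mu].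
Proof.
move=> fL f0; have := Lfun2_Lnorm fL; rewrite f0 sqrtr0.
move/(Lnorm_eq0_eq0 _) => h.
have /h : measurable_fun setT (EFin \o f) by exact/measurable_EFinP/(@Lfun2_measurable f).
move=> /(_ ltac:(by rewrite lte_fin)).
by apply: filterS => x /(_ I) [].
Qed.

End L2.

Section integrable_EFin.
Context d (T : measurableType d) (R : realType).
Variables (mu : {measure set T -> \bar R}) (D : set T) (mD : measurable D).

Lemma integrableZl_EFin (k : R) (f : T -> R) : mu.-integrable D (EFin \o f) ->
  mu.-integrable D (EFin \o (fun x => k * f x)).
Proof. by move=> fi; apply: eq_integrable (integrableZl mD k fi) => // x _ /=; rewrite EFinM. Qed.

Lemma integrableD_EFin (f g : T -> R) : mu.-integrable D (EFin \o f) ->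
  mu.-integrable D (EFin \o g) -> mu.-integrable D (EFin \o (fun x => f x + g x)).
Proof. by move=> fi gi; apply: eq_integrable (integrableD mD fi gi) => // x _ /=; rewrite EFinD. Qed.

End integrable_EFin.

(** * Completeness of L^2 over a finite measure *)

Section L2_complete.
Context d (T : measurableType d) (R : realType).
Variable mu : {finite_measure set T -> \bar R}.

Local Notation L2 := (Lfun mu 2%:E).
Local Notation "<< f , g >>" := (\int[mu]_x (f x * g x)).

Lemma Lfun2_bdd (b : T -> R) (M : R) : measurable_fun setT b ->
  (forall x, `|b x| <= M) -> b \in L2.
Proof.
move=> mb bM; rewrite (_ : b = fun x => b x * cst 1 x); last first.
  by apply/funext => x; rewrite mulr1.
by apply: (Lfun2_bddM mb bM); exact: Lfun_cst.
Qed.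

(** On a finite measure the L^2 rate gives an L^1 rate, so the sum of the absolute increments is
    integrable, hence finite almost everywhere, and the telescoping series converges absolutely
    there. *)
Lemma cauchy_fast_cvg_ae (u : nat -> T -> R) (K : R) : (forall n, u n \in L2) ->
  (forall n, <<u n.+1 - u n, u n.+1 - u n>> <= K * 4^-1 ^+ n) ->
  {ae mu, forall t, cvgn (u ^~ t)}.
Proof.
move=> uL uK.
pose D n t : R := `|u n.+1 t - u n t|.
have D0 n t : (0 <= (D n t)%:E)%E by rewrite lee_fin normr_ge0.
have duL n : u n.+1 - u n \in L2 by exact: Lfun2B.
have mD n : measurable_fun setT (EFin \o D n).
  by apply/measurable_EFinP/measurableT_comp => //; exact: Lfun2_measurable (duL n).
(* The integral of the AM-GM bound is at most (2^-n mu(T) + 2^n K 4^-n) / 2 = M 2^-n. *)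
pose M := (fine (mu setT) + K) / 2.
(* AM-GM: [|a| <= (2^-n + 2^n a^2) / 2] *)
have iD n : (\int[mu]_t (D n t)%:E <= (M * 2^-1 ^+ n)%:E)%E.
  have i1 : mu.-integrable setT (EFin \o cst (2^-1 ^+ n / 2 : R)).
    exact: finite_measure_integrable_cst.
  have i2 : mu.-integrable setT (EFin \o (fun t => 2 ^+ n / 2 *
      ((u n.+1 - u n) t * (u n.+1 - u n) t))).
    by apply: integrableZl_EFin => //; exact: Lfun2_integrableM.
  have -> : (M * 2^-1 ^+ n) = \int[mu]_t (cst (2^-1 ^+ n / 2) t) +
      2 ^+ n / 2 * (K * 4^-1 ^+ n).
    rewrite Rintegral_cst// /M.
    have -> : 4^-1 ^+ n = 2^-1 ^+ n * 2^-1 ^+ n :> R by rewrite -exprMn; congr (_ ^+ _); lra.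
    by rewrite !exprVn; field; rewrite expf_neq0.
  apply: (@le_trans _ _ (\int[mu]_t (2^-1 ^+ n / 2 + 2 ^+ n / 2 *
      ((u n.+1 - u n) t * (u n.+1 - u n) t)))%:E).
    rewrite /Rintegral fineK; last first.
      by apply: integrable_fin_num => //; exact: integrableD_EFin.
    apply: ge0_le_integral => //.
    - exact: mD.
    - by apply: (measurable_int mu); exact: integrableD_EFin.
    - move=> t _; rewrite lee_fin /D.
      set a := u n.+1 t - u n t; rewrite -[(_ - _) t]/a.
      have p0 : 0 < 2 ^+ n :> R by rewrite exprn_gt0.
      rewrite exprVn.
      have -> : (2 ^+ n)^-1 / 2 + 2 ^+ n / 2 * (a * a) =
        `|a| + (2 ^+ n)^-1 / 2 * (1 - 2 ^+ n * `|a|) ^+ 2 :> R.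
        have -> : a * a = `|a| * `|a| by rewrite -!expr2 real_normK ?num_real.
        by field; rewrite gt_eqF.
      by rewrite lerDl mulr_ge0 ?sqr_ge0// divr_ge0// invr_ge0 ltW.
  rewrite lee_fin RintegralD//; rewrite lerD2l RintegralZl//; last exact: Lfun2_integrableM.
  by rewrite ler_wpM2l// divr_ge0// exprn_ge0.
have sD : (\int[mu]_t (\sum_(n <oo) (D n t)%:E) < +oo)%E.
  rewrite integral_nneseries//.
  apply: (@le_lt_trans _ _ (\sum_(n <oo) (M * 2^-1 ^+ n)%:E)%E).
    apply: lee_nneseries => [n _ _|n _]; last exact: iD.
    by apply: integral_ge0 => t _; exact: D0.
  have M0 : 0 <= M.
    rewrite -lee_fin; have := iD 0%N; rewrite expr0 mulr1; apply: le_trans.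
    exact: integral_ge0.
  have := @cvg_geometric_series R M 2^-1.
  rewrite ger0_norm// => /(_ ltac:(rewrite invf_lt1// ltr1n//)) c.
  have -> : (\sum_(n <oo) (M * 2^-1 ^+ n)%:E = (M * (1 - 2^-1)^-1)%:E)%E.
    apply/cvg_lim => //.
    rewrite (_ : (fun _ => _) = EFin \o series (geometric M 2^-1)); last first.
      by apply/funext => n /=; rewrite /series/= sumEFin.
    by apply: cvg_EFin; [exact: nearW|exact: c].
  exact: ltry.
have /integrable_ae : mu.-integrable setT (fun t => \sum_(n <oo) (D n t)%:E)%E.
  apply/integrableP; split.
    by apply: ge0_emeasurable_sum => [n t _ _|n _]; [exact: D0|exact: mD].
  apply: le_lt_trans sD; rewrite le_eqVlt; apply/orP; left; apply/eqP.
  by apply: eq_integral => t _; rewrite gee0_abs// nneseries_ge0.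
move=> /(_ measurableT); apply: filterS => t /(_ I) fint.
have cs : cvgn (series (fun n => u n.+1 t - u n t)).
  apply: normed_cvg => /=.
  apply: nondecreasing_is_cvgn; first by apply: nondecreasing_series => *; exact: normr_ge0.
  exists (fine (\sum_(n <oo) (D n t)%:E)%E) => _ [n _ <-].
  rewrite -lee_fin fineK// /series/= -sumEFin.
  exact: nneseries_lim_ge.
rewrite (_ : u ^~ t = (fun n => series (fun n => u n.+1 t - u n t) n + u 0%N t)).
  by apply: is_cvgD => //; exact: is_cvg_cst.
by apply/funext => n; rewrite /series/= telescope_sumr// subrK.
Qed.

(** Induction with (a + b)^2 <= 2 a^2 + 2 b^2. The factor 4 reproduces itself: 2 (4 K / 4) + 2 K = 4
    K. *)
Lemma cauchy_fast_tail (u : nat -> T -> R) (K : R) : (forall n, u n \in L2) ->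
  (forall n, <<u n.+1 - u n, u n.+1 - u n>> <= K * 4^-1 ^+ n) ->
  forall m n, <<u (m + n)%N - u n, u (m + n)%N - u n>> <= 4 * K * 4^-1 ^+ n.
Proof.
move=> uL uK.
have K0 : 0 <= K.
  by have := uK 0; rewrite expr0 mulr1; apply: le_trans; exact: ip_ge0.
elim=> [|m IH] n.
  rewrite add0n subrr (_ : \int[mu]_x _ = 0).
    by rewrite mulr_ge0 ?mulr_ge0// exprn_ge0.
  by rewrite /Rintegral integral0_eq// => x _; rewrite mul0r.
set a := u (m + n.+1)%N - u n.+1; set b := u n.+1 - u n.
have aL : a \in L2 by exact: Lfun2B.
have bL : b \in L2 by exact: Lfun2B.
have -> : u (m.+1 + n)%N - u n = a + b.
  by rewrite /a /b addSnnS addrA subrK.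
have iaa := Lfun2_integrableM aL aL; have ibb := Lfun2_integrableM bL bL.
apply: (@le_trans _ _ (2 * <<a, a>> + 2 * <<b, b>>)); last first.
  have := IH n.+1; have := uK n; rewrite -/a -/b exprS.
  lra.
rewrite -!RintegralZl// -RintegralD//; last 2 first.
- exact: (integrableZl_EFin measurableT 2 iaa).
- exact: (integrableZl_EFin measurableT 2 ibb).
apply: le_Rintegral => //.
- by apply: Lfun2_integrableM; exact: Lfun2D.
- by apply: (integrableD_EFin measurableT (integrableZl_EFin measurableT 2 iaa)
    (integrableZl_EFin measurableT 2 ibb)).
- move=> x _; rewrite -[(a + b) x]/(a x + b x).
  have := sqr_ge0 (a x - b x); nra.
Qed.

Lemma Lfun2_complete (u : nat -> T -> R) (K : R) : (forall n, u n \in L2) ->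
  (forall n, <<u n.+1 - u n, u n.+1 - u n>> <= K * 4^-1 ^+ n) ->
  exists2 v, v \in L2 & <<u n - v, u n - v>> @[n --> \oo] --> 0.
Proof.
move=> uL uK.
have [N [mN N0 Nu]] := cauchy_fast_cvg_ae uL uK.
(* An upper limit is measurable everywhere and agrees with the limit off [N]; [fine] sends infinite
   values on [N] to 0. *)
pose v t : R := fine (limn_esup (fun n => (u n t)%:E)).
have uv t : ~ N t -> u n t @[n --> \oo] --> v t.
  move=> Nt; have ut : cvgn (u ^~ t) by apply: contrapT => h; exact/Nt/Nu.
  have ce : (u n t)%:E @[n --> \oo] --> (limn (u ^~ t))%:E.
    by apply: cvg_EFin; [exact: nearW|exact: ut].
  rewrite /v is_cvg_limn_esupE; last by apply/cvg_ex; eexists; exact: ce.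
  by rewrite (cvg_lim _ ce).
have mv : measurable_fun setT v.
  apply: measurableT_comp => //; apply: measurable_fun_limn_esup => n.
  exact/measurable_EFinP/(Lfun2_measurable (uL n)).
(* Fatou's lemma in [m], off [N], applied to the squares of [u (m + n) - u n], whose integrals the
   tail bound controls uniformly in [m]. *)
have main n : (\int[mu]_t ((u n - v) t * (u n - v) t)%:E <= (4 * K * 4^-1 ^+ n)%:E)%E.
  have mf m : measurable_fun setT (fun t => ((u (m + n)%N - u n) t * (u (m + n)%N - u n) t)%:E).
    by apply/measurable_EFinP; apply: measurable_funM; apply: Lfun2_measurable; apply: Lfun2B.
  rewrite (ge0_negligible_integral mN)//; last 2 first.
  - apply/measurable_EFinP; apply: measurable_funM; apply: measurable_funB => //;
      exact: Lfun2_measurable (uL n).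
  - by move=> t _; rewrite lee_fin -expr2 sqr_ge0.
  rewrite setTD.
  have -> : (\int[mu]_(t in ~` N) ((u n - v) t * (u n - v) t)%:E =
     \int[mu]_(t in ~` N) limn_einf (fun m => ((u (m + n)%N - u n) t * (u (m + n)%N - u n) t)%:E))%E.
    apply: eq_integral => t; rewrite inE => Nt.
    have c : ((u (m + n)%N - u n) t * (u (m + n)%N - u n) t)%:E @[m --> \oo] -->
        ((u n - v) t * (u n - v) t)%:E.
      apply: cvg_EFin; first exact: nearW.
      have c1 : (u (m + n)%N - u n) t @[m --> \oo] --> - (u n - v) t.
        rewrite opprB; apply: cvgB; last exact: cvg_cst.
        by rewrite (cvg_shiftn n (u ^~ t)); exact: uv.
      by rewrite -mulrNN; exact: cvgM.
    rewrite is_cvg_limn_einfE; last by apply/cvg_ex; eexists; exact: c.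
    by apply/esym/cvg_lim.
  apply: (le_trans (fatou _ _ _ _)).
  - exact: measurableC.
  - by move=> m; apply: measurable_funTS.
  - by move=> m t _; rewrite lee_fin -expr2 sqr_ge0.
  rewrite limn_einf_lim; apply: lime_le; first exact: is_cvg_einfs.
  apply: nearW => m; apply: ereal_inf_le.
  exists (\int[mu]_(t in ~` N) ((u (m + n)%N - u n) t * (u (m + n)%N - u n) t)%:E)%E.
    by exists m => /=.
  apply: (@le_trans _ _ (\int[mu]_t ((u (m + n)%N - u n) t * (u (m + n)%N - u n) t)%:E)%E).
    apply: ge0_subset_integral => //; first exact: measurableC.
    by move=> t _; rewrite lee_fin -expr2 sqr_ge0.
  have := cauchy_fast_tail uL uK m n; rewrite -lee_fin; apply: le_trans.
  rewrite /Rintegral fineK//; apply: integrable_fin_num => //.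
  by apply: Lfun2_integrableM; exact: Lfun2B.
have uvL n : u n - v \in L2.
  apply: Lfun2P; first by apply: measurable_funB => //; exact: Lfun2_measurable (uL n).
  by apply: le_lt_trans (main n) _; exact: ltry.
exists v; first by rewrite -[v](subKr (u 0)); exact: Lfun2B.
apply: (@squeeze_cvgr _ _ _ _ (cst 0) (fun n => 4 * K * 4^-1 ^+ n)).
- apply: nearW => n /=; rewrite ip_ge0/= -lee_fin.
  apply: le_trans (main n).
  rewrite /Rintegral fineK//; apply: integrable_fin_num => //.
  exact: Lfun2_integrableM.
- exact: cvg_cst.
- rewrite -[X in _ --> X](mulr0 (4 * K)); apply: cvgM; first exact: cvg_cst.
  by apply: cvg_expr; rewrite ger0_norm ?invr_ge0// invf_lt1// ltr1n.
Qed.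

End L2_complete.

(** * Restricted measures, circle measures and periodic functions *)

(** The complement of [D] is null for the restricted measure, so [f] may be arbitrary. *)
Lemma integral_mrestr d (T : measurableType d) (R : realType)
    (mu : {measure set T -> \bar R}) (D : set T) (mD : measurable D) (f : T -> \bar R) :
  (\int[mrestr mu mD]_x f x = \int[mu]_(x in D) f x)%E.
Proof.
transitivity (\int[mrestr mu mD]_(x in D) f x)%E.
  rewrite [RHS]integral_mkcond.
  apply: (@eq_integral_off_null _ _ _ (mrestr mu mD) (~` D)).
  - exact: measurableC.
  - by rewrite /= /mrestr setICl measure0.
  - by move=> x /contrapT Dx; rewrite patchE mem_set.
by apply: eq_measure_integral => A mA AD; rewrite /= /mrestr setIidl.
Qed.

Section circle.
Context {R : realType}.
Implicit Types (W : cumulative R R) (f : R -> R).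

Lemma lebesgue_stieltjes_itv_oc W (a b : R) : a <= b ->
  lebesgue_stieltjes_measure W `]a, b]%classic = (W b - W a)%:E.
Proof.
move=> ab; rewrite /lebesgue_stieltjes_measure /measure_extension/=.
rewrite measurable_mu_extE/=; last exact: is_ocitv.
by rewrite wlength_itv_bnd.
Qed.

Lemma integral_circle W (g : R -> \bar R) : (\int[circle_measure W]_x g x =
  \int[lebesgue_stieltjes_measure W]_(x in `[0%R, 1%R[) g x)%E.
Proof. exact: integral_mrestr. Qed.

Lemma Rintegral_circle W f : \int[circle_measure W]_x f x =
  \int[lebesgue_stieltjes_measure W]_(x in `[0, 1[) f x.
Proof. by congr fine; exact: integral_circle. Qed.

Definition frac (x : R) : R := x - (Num.floor x)%:~R.

Lemma frac_itv x : 0 <= frac x < 1.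
Proof.
have /andP[h1 h2] := floor_itv x; rewrite /frac subr_ge0 h1/= ltrBlDl.
by rewrite intrD in h2.
Qed.

Lemma fracE x : 0 <= x < 1 -> frac x = x.
Proof.
move=> x01; rewrite /frac (@floor_def _ _ 0) ?subr0//.
Qed.

Lemma periodic_int f (n : int) x : periodic f 1 -> f (x + n%:~R) = f x.
Proof.
move=> pf; case: n => n.
  by rewrite -pmulrn (periodicn pf).
have := periodicn pf n.+1 (x - n.+1%:R); rewrite subrK => ->.
by rewrite NegzE mulrNz -pmulrn.
Qed.

Lemma periodic_frac f x : periodic f 1 -> f (frac x) = f x.
Proof. by move=> pf; rewrite /frac -mulrNz periodic_int. Qed.

Lemma measurable_frac : measurable_fun setT frac.
Proof.
apply: measurable_funB => //; apply: nondecreasing_measurable => // x y xy.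
by rewrite ler_int le_floor.
Qed.

End circle.

Section bounded.
Context d (T : measurableType d) (R : realType) (mu : {measure set T -> \bar R}).
Variables (D : set T) (mD : measurable D) (Dfin : (mu D < +oo)%E).
Variables (h : T -> R) (M : R) (mh : measurable_fun D h).
Hypothesis hM : forall x, D x -> `|h x| <= M.

Lemma integrable_bdd : mu.-integrable D (EFin \o h).
Proof.
apply: measurable_bounded_integrable => //.
exists M; split; first exact: num_real.
by move=> y My x Dx; apply: (le_trans (hM Dx)); exact: ltW.
Qed.

Lemma Rintegral_bdd : `|\int[mu]_(x in D) h x| <= M * fine (mu D).
Proof.
apply: (le_trans (le_normr_Rintegral mD integrable_bdd)).
rewrite -Rintegral_cst//; apply: le_Rintegral => //.
- exact: integrable_norm integrable_bdd.
- by apply: measurable_bounded_integrable => //; exists `|M|; split => // y My x _; exact: ltW.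
Qed.

End bounded.

(** * Regularity of one-dimensional eigenfunctions *)

Section eigenfunction.
Context {R : realType}.
Variables (W : cumulative R R).
Hypothesis W_incr : forall s t : R, s < t -> W s < W t.
Hypothesis W_per : forall s : R, W (s + 1) - W s = W 1 - W 0.
Variables (f : R -> R) (c : R).
Hypothesis fLW : LW_graph W f (fun x => c * f x).

Local Notation leb := (@lebesgue_measure R).
Local Notation lebT := (circle_measure (idfun : cumulative R R)).
Local Notation mW := (lebesgue_stieltjes_measure W).

Let W_le s t : s <= t -> W s <= W t.
Proof. by rewrite le_eqVlt => /predU1P[->//|/W_incr/ltW]. Qed.

Let G y := \int[leb]_(z in `[0, y]) (c * f z).

Let f_meas : measurable_fun setT f.
Proof. by have [/Lfun2_measurable] := fLW. Qed.

Let f_per : periodic f 1.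
Proof. by have [] := fLW. Qed.

Let cf_int_co : leb.-integrable `[0, 1[ (EFin \o (fun z => c * f z)).
Proof.
have [_ _ cfL _ _] := fLW.
have /Lfun1_integrable/integrableP[m fin] : (fun z => c * f z) \in Lfun lebT 1.
  by apply: Lfun_subset12 => //; exact: fin_num_measure.
apply/integrableP; split; first exact: measurable_funTS.
by move: fin; rewrite integral_circle.
Qed.

Let cf_int : leb.-integrable `[0, 1] (EFin \o (fun z => c * f z)).
Proof.
have [m fin] := integrableP _ _ _ cf_int_co.
have m1 : measurable_fun (`[0, 1] : set R) (EFin \o (fun z => c * f z)).
  by apply/measurable_EFinP/measurable_funTS/measurable_funM.
apply/integrableP; split => //.
rewrite -integral_itv_bndo_bndc//.
exact: measurableT_comp.
Qed.

Let G_cont : {within `[0, 1], continuous G}.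
Proof. exact: (parameterized_integral_continuous ler01 cf_int). Qed.

Let G_meas : measurable_fun (`[0, 1] : set R) G.
Proof. exact: subspace_continuous_measurable_fun. Qed.

Let M0 := \int[leb]_(z in `[0, 1]) `|c * f z|.

Let G_M0 (y : R) : 0 <= y <= 1 -> `|G y| <= M0.
Proof.
move=> /andP[y0 y1].
have sub : `[0, y] `<=` `[0, 1] by apply: subset_itvl; rewrite bnd_simp.
have i : leb.-integrable `[0, y] (EFin \o (fun z => c * f z)).
  exact: integrableS cf_int.
apply: (le_trans (le_normr_Rintegral _ i)) => //.
rewrite /M0 /Rintegral fine_le//.
- by apply: integrable_fin_num => //; exact: integrable_norm.
- by apply: integrable_fin_num => //; exact: integrable_norm.
- apply: ge0_subset_integral => //.
  by apply/measurable_EFinP/measurableT_comp/measurable_funTS/measurable_funM.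
Qed.

Let G0 : G 0 = 0.
Proof. by rewrite /G set_itv1 Rintegral_set1. Qed.

Let G1 : G 1 = 0.
Proof. by have [] := fLW. Qed.

Let mW_fin (s t : R) : (mW `]s, t] < +oo)%E.
Proof.
have [st|ts] := leP s t; first by rewrite lebesgue_stieltjes_itv_oc// ltry.
by rewrite set_itv_ge ?measure0// bnd_simp -leNgt ltW.
Qed.

(** [b * W x] becomes the [W]-integral of the constant [b] once [b * W 0] is absorbed into [a]. The
    formula then extends to [x = 1]: there [f 1 = f 0] by periodicity, and the integral of [F]
    vanishes. *)
Let F_spec : exists a b : R,
  let F y := b + G y in
  [/\ \int[mW]_(y in `]0, 1]) F y = 0 &
    forall x, 0 <= x <= 1 -> f x = a + \int[mW]_(y in `]0, x]) F y].
Proof.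
have [_ _ _ _ [a [b [F0 fE]]]] := fLW.
exists (a + b * W 0), b => /=.
have oc (s : R) : s <= 1 -> `]0, s] `<=` `[0, 1].
  move=> s1 z /=; rewrite !in_itv/= => /andP[z0 zs].
  by rewrite (ltW z0) (le_trans zs s1).
have iG s : s <= 1 -> mW.-integrable `]0, s] (EFin \o G).
  move=> s1; apply: (integrable_bdd _ (mW_fin _ _) (M := M0)) => //.
    by apply: measurable_funS G_meas => //; exact: oc.
  by move=> z /(oc s s1) /=; rewrite in_itv/=; exact: G_M0.
have ib s : mW.-integrable `]0, s] (EFin \o cst b).
  by apply: (integrable_bdd _ (mW_fin _ _) (M := `|b|)).
have FE s : 0 <= s <= 1 ->
    \int[mW]_(y in `]0, s]) (b + G y) = b * (W s - W 0) + \int[mW]_(y in `]0, s]) G y.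
  move=> /andP[s0 s1]; rewrite RintegralD//; last exact: iG.
  by rewrite Rintegral_cst//= lebesgue_stieltjes_itv_oc.
split=> // x /andP[x0]; rewrite le_eqVlt => /predU1P[->|x1].
  rewrite F0 addr0 -[1]add0r f_per fE ?in_itv/= ?lexx ?ltr01//.
  by rewrite set_itv_ge ?bnd_simp ?ltxx// Rintegral_set0 addr0.
rewrite fE ?in_itv/= ?x0// FE ?x0 ?ltW// -/G.
set I := (X in _ + X = _); rewrite -[X in _ = _ + (_ + X)]/I.
ring.
Qed.

Let F_bdd b (y : R) : 0 <= y <= 1 -> `|b + G y| <= `|b| + M0.
Proof. by move=> y01; rewrite (le_trans (ler_normD _ _))// lerD2l G_M0. Qed.

Let F_int b (s t : R) : 0 <= s -> t <= 1 ->
  mW.-integrable `]s, t] (EFin \o (fun y => b + G y)).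
Proof.
move=> s0 t1; have st : `]s, t] `<=` (`[0, 1] : set R).
  move=> z /=; rewrite !in_itv/= => /andP[sz zt].
  by rewrite (le_trans s0 (ltW sz)) (le_trans zt t1).
apply: (integrable_bdd _ (mW_fin _ _) (M := `|b| + M0)) => //.
  by apply: measurable_funD => //; apply: measurable_funS G_meas.
by move=> z /st; rewrite /= in_itv/=; exact: F_bdd.
Qed.

(** Over [0, 1], [f] is an integral of a bounded function against a finite measure. Since the
    density of [G] is [c * f], this bound makes [G] Lipschitz. *)
Lemma eigenfunction_bdd : exists M, forall x, `|f x| <= M.
Proof.
have [a [b [_ fE]]] := F_spec.
exists (`|a| + (`|b| + M0) * (W 1 - W 0)) => x.
rewrite -(periodic_frac _ f_per) fE; last first.
  by have /andP[-> /ltW->] := frac_itv x.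
rewrite (le_trans (ler_normD _ _))// lerD2l.
have /andP[r0 r1] := frac_itv x.
have bM : 0 <= `|b| + M0 by apply: le_trans (F_bdd b (y := 0) _); rewrite ?lexx ?ler01.
apply: (le_trans (Rintegral_bdd _ (mW_fin _ _) (M := `|b| + M0) _ _)) => //.
- by have /measurable_int/measurable_EFinP := F_int b (lexx 0) (ltW r1).
- move=> z /=; rewrite in_itv/= => /andP[z0 zr].
  by rewrite F_bdd// (ltW z0) (le_trans zr)// ltW.
- rewrite /= lebesgue_stieltjes_itv_oc//=; rewrite ler_wpM2l// lerD2r.
  by apply: W_le; exact: ltW.
Qed.

Let G_lip : exists2 L : R, 0 <= L & forall y z : R, 0 <= y -> y <= z -> z <= 1 ->
  `|G z - G y| <= L * (z - y).
Proof.
have [M fM] := eigenfunction_bdd.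
exists (`|c| * M) => [|y z y0 yz z1].
  by rewrite mulr_ge0// (le_trans _ (fM 0)).
have iz : leb.-integrable `[0, z] (EFin \o (fun z => c * f z)).
  by apply: integrableS cf_int => //; apply: subset_itvl; rewrite bnd_simp.
have mI : leb `]y, z]%classic = (z - y)%:E by exact: lebesgue_stieltjes_itv_oc.
rewrite /G Rintegral_itvB//.
apply: (le_trans (Rintegral_bdd _ _ (M := `|c| * M) _ _)) => //.
- by rewrite /= mI ltry.
- by apply/measurable_funTS/measurable_funM.
- by move=> x _; rewrite normrM ler_wpM2l.
- by rewrite /= mI.
Qed.

(** On []s, t]] the integrand stays within [L * (t - s)] of its value at [y]. As [y] is any point of
    [[s, t]], taking it as either endpoint covers both one-sided quotients. *)
Let f_incr : exists b L : R, [/\ 0 <= L, \int[mW]_(y in `]0, 1]) (b + G y) = 0 &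
  forall s t y : R, 0 <= s -> s <= y -> y <= t -> t <= 1 ->
    `|f t - f s - (b + G y) * (W t - W s)| <= L * (t - s) * (W t - W s)].
Proof.
have [a [b [F0 fE]]] := F_spec; have [L L0 GL] := G_lip.
exists b, L; split => // s t y s0 sy yt t1.
have st : s <= t by exact: le_trans yt.
rewrite !fE ?s0 ?t1 ?(le_trans s0)// ?(le_trans st)//.
have -> : `]0, t]%classic = `]0, s] `|` `]s, t] :> set R.
  by rewrite -itv_bndbnd_setU// bnd_simp.
rewrite Rintegral_setU//; last 2 first.
- rewrite -itv_bndbnd_setU ?bnd_simp//; exact: F_int.
- apply/disj_setPS => z [/=]; rewrite !in_itv/= => /andP[_ zs] /andP[].
  by rewrite ltNge zs.
rewrite opprD addrACA subrr add0r [X in X - _]addrAC subrr add0r.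
have -> : (b + G y) * (W t - W s) = \int[mW]_(z in `]s, t]) (b + G y).
  by rewrite Rintegral_cst//= lebesgue_stieltjes_itv_oc.
have ic : mW.-integrable `]s, t] (EFin \o (cst (b + G y))).
  by apply: (integrable_bdd _ (mW_fin _ _) (M := `|b + G y|)).
rewrite -RintegralB//; last exact: F_int.
have := @Rintegral_bdd _ _ R mW `]s, t] (measurable_itv _) (mW_fin s t)
  (fun z => b + G z - (b + G y)) (L * (t - s)).
rewrite /= lebesgue_stieltjes_itv_oc//=; apply.
- apply: measurable_funB => //.
  by have /measurable_int/measurable_EFinP := F_int b s0 t1.
- move=> z /=; rewrite in_itv/= => /andP[sz zt].
  rewrite (_ : b + G z - (b + G y) = G z - G y); last by ring.
  have [yz|zy] := leP y z.
    rewrite (le_trans (GL _ _ _ yz _))// ?(le_trans s0)// ?(le_trans zt)//.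
    by rewrite ler_wpM2l//; lra.
  rewrite distrC (le_trans (GL _ _ _ (ltW zy) _))// ?(le_trans s0 (ltW sz))// ?(le_trans yt)//.
  by rewrite ler_wpM2l//; lra.
Qed.

Let quotient_le : exists b L : R, [/\ 0 <= L, \int[mW]_(y in `]0, 1]) (b + G y) = 0 &
  forall s t y : R, 0 <= s -> s <= y -> y <= t -> t <= 1 -> s < t ->
    `|(f t - f s) / (W t - W s) - (b + G y)| <= L * (t - s)].
Proof.
have [b [L [L0 F0 bL]]] := f_incr; exists b, L; split => // s t y s0 sy yt t1 st.
have Wst : 0 < W t - W s by rewrite subr_gt0 W_incr.
rewrite -(ler_pM2r Wst) -[X in _ * X <= _]ger0_norm ?(ltW Wst)// -normrM mulrBl.
by rewrite divfK ?gt_eqF//; exact: bL.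
Qed.

Let W_frac x s : W (frac x + s) - W (frac x) = W (x + s) - W x.
Proof.
(* [W] minus its linear drift is periodic, so increments of [W] are invariant under integer
   shifts. *)
have [g [pg WE]] : exists g, periodic g 1 /\ forall t, W t = g t + (W 1 - W 0) * t.
  by exists (fun t => W t - (W 1 - W 0) * t); split => t; [have := W_per t; lra|ring].
rewrite (WE (frac x + s)) (WE (frac x)) (WE (x + s)) (WE x) (periodic_frac _ pg).
rewrite (_ : g (frac x + s) = g (x + s)); last first.
  rewrite -[RHS](periodic_int (- Num.floor x) _ pg); congr g.
  by rewrite /frac mulrNz; ring.
by ring.
Qed.

Let f_frac x s : f (frac x + s) - f (frac x) = f (x + s) - f x.
Proof.
rewrite (periodic_frac _ f_per); congr (_ - _).
rewrite -[RHS](periodic_int (- Num.floor x) _ f_per); congr f.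
by rewrite /frac mulrNz; ring.
Qed.

Let cvg_quotient (b L x : R) : 0 <= L ->
  (forall s t y : R, 0 <= s -> s <= y -> y <= t -> t <= 1 -> s < t ->
    `|(f t - f s) / (W t - W s) - (b + G y)| <= L * (t - s)) ->
  (f (x + e) - f x) / (W (x + e) - W x) @[e --> 0^'] --> b + G (frac x).
Proof.
move=> L0 fL.
have /andP[y0 y1] := frac_itv x.
under eq_fun do rewrite -f_frac -W_frac.
move: (frac x) y0 y1 => {x} y y0 y1.
apply/subr_cvg0.
(* For [|e| < k] the point [y + e] stays in [0, 1], except when [y = 0] and [e < 0]. *)
pose k := if y == 0 then 1 else Num.min y (1 - y).
have k0 : 0 < k.
  by rewrite /k; case: eqVneq => // yn0; rewrite lt_min lt_neqAle eq_sym yn0 y0 subr_gt0.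
apply: (cvg_to_0_linear (K := L) k0) => e /andP[en ek] /=.
have e0 : e != 0 by rewrite -normr_gt0.
have [ep|en0] := ltP 0 e.
  rewrite gtr0_norm// in ek *.
  have := fL y (y + e) y y0 (lexx y); rewrite addrAC subrr add0r; apply; rewrite ?lerDl ?ltrDl// ?ltW//.
  move: ek; rewrite /k; case: eqVneq => [->|_]; first by rewrite add0r.
  by rewrite lt_min => /andP[_]; lra.
have {e0 en0}en0 : e < 0 by rewrite lt_neqAle e0.
rewrite ltr0_norm// in ek *.
have quot (p q r s : R) : (p - q) / (r - s) = (q - p) / (s - r).
  by rewrite -[in LHS]opprB -[r - s]opprB invrN mulrNN.
have [yy|yn0] := eqVneq y 0.
  (* At 0 a left increment is shifted by one period to the interval from [e + 1] to 1; the limit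
     found there is [b + G 1], which is [b + G 0] since both values of [G] vanish. *)
  rewrite /k yy eqxx in ek; rewrite yy add0r.
  rewrite -[f e]f_per -[f 0]f_per add0r.
  have -> : W e - W 0 = W (e + 1) - W 1 by have := W_per e; lra.
  rewrite quot G0 -G1.
  have := fL (e + 1) 1 1; rewrite (_ : 1 - (e + 1) = - e); last by ring.
  by apply => //; lra.
rewrite quot.
have := fL (y + e) y y; rewrite (_ : y - (y + e) = - e); last by ring.
rewrite /k (negbTE yn0) lt_min in ek; move/andP : ek => [ek _].
by apply => //; lra.
Qed.

(** An atom is the limit of the increments of [W] over shrinking intervals to its left, and these
    are the same at 0 and at 1. This identifies the endpoint mass of []0, 1]] in [LW_graph] with
    that of [[0, 1[] in [circle_measure]. *)
Let mW_set1 : mW [set (0 : R)] = mW [set (1 : R)].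
Proof.
have cv (x : R) : (W x - W (x - n.+1%:R^-1))%:E @[n --> \oo] --> mW [set x].
  have xE : [set x] = \bigcap_n `]x - n.+1%:R^-1, x]%classic.
    apply/seteqP; split => [_ -> n _ /=|z zx].
      by rewrite in_itv/= lexx andbT ltrBlDr ltrDl invr_gt0.
    apply/eqP; rewrite eq_le.
    have /= := zx 0%N I; rewrite in_itv/= => /andP[_ ->]/=.
    apply/ler_addgt0Pr => e e0.
    near \oo => n.
    have /= := zx n I; rewrite in_itv/= => /andP[xz _].
    rewrite -lerBlDr (le_trans _ (ltW xz))// lerD2l lerN2.
    by near: n; apply: filterS (near_infty_natSinv_lt (PosNum e0)) => m /ltW.
  have -> : (fun n => (W x - W (x - n.+1%:R^-1))%:E) =
      mW \o (fun n => `]x - n.+1%:R^-1, x]%classic).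
    apply/funext => n /=; rewrite lebesgue_stieltjes_itv_oc//.
    by rewrite gerBl invr_ge0.
  rewrite [in X in _ --> X]xE; apply: nonincreasing_cvg_mu => //.
  - exact: mW_fin.
  - by rewrite -xE.
  - move=> m n mn; apply/subsetPset; apply: subset_itvr; rewrite bnd_simp.
    by rewrite lerD2l lerN2 lef_pV2 ?posrE// ler_nat.
apply: (cvg_unique _ (cv 0)) => //.
apply: cvg_trans (cv 1); apply: near_eq_cvg; apply: nearW => n.
congr EFin; have := W_per (0 - n.+1%:R^-1).
rewrite (_ : 0 - n.+1%:R^-1 + 1 = 1 - n.+1%:R^-1); last by ring.
by lra.
Unshelve. all: by end_near. Qed.

Let G_derive : {ae leb, forall x : R, 0 < x < 1 -> is_derive x 1 G (c * f x)}.
Proof.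
(* Integrability of [c * f] is known on [0, 1]; extension by zero meets the global hypotheses of the
   differentiation theorem. *)
pose h := (fun z => c * f z) \_ (`[0, 1] : set R).
have hloc : locally_integrable setT h.
  by apply: integrable_locally => //; exact: cf_int.
have hint y : leb.-integrable `[0, y] (EFin \o h).
  rewrite /h -restrict_EFin; apply/integrable_restrict => //.
  by apply: integrableS cf_int; [exact: measurable_itv|apply: measurableI; exact: measurable_itv|exact: subIsetr].
have := @FTC1 R h (BLeft 0) hint hloc.
apply: filterS; first exact: (ae_filter_ringOfSetsType leb).
move=> x + /andP[x0 x1].
have b0 : (0%:E < x%:E)%E by rewrite lte_fin.
move=> /(_ b0)[dF F'].
have -> : c * f x = h x by rewrite /h patchE mem_set//= in_itv/= !ltW.
have : is_derive x 1 (fun y : R => \int[leb]_(t in `[0, y]) h t) (h x).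
  by rewrite -F' derive1E; exact: derivableP.
apply: near_eq_is_derive.
near=> y; rewrite /G /h -Rintegral_mkcondr.
congr (Rintegral _ _ _); apply/seteqP; split => [z []//|z /=].
rewrite !in_itv/= => /andP[z0 zy]; rewrite z0 zy; split => //=.
rewrite (le_trans zy)//; near: y.
exact: lt_le_nbhsl.
Unshelve. all: by end_near. Qed.

(* [LW_graph] retains a bounded representative, whose [W]-derivative exists
   everywhere because its increments are the [W]-integrals of a Lipschitz
   function. *)
Lemma eigenfunction_gen_derive : exists F : R -> R,
  [/\ measurable_fun setT F, (exists M, forall x, `|F x| <= M),
      \int[circle_measure W]_x F x = 0,
      forall x, (f (x + e) - f x) / (W (x + e) - W x) @[e --> 0^'] --> F x &
      {ae leb, forall x : R, 0 < x < 1 -> is_derive x 1 F (c * f x)}].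
Proof.
have [b [L [L0 F0 fL]]] := quotient_le.
exists (fun x => b + G (frac x)); split.
- apply: measurable_funD => //.
  apply: (measurable_comp _ _ G_meas measurable_frac) => //.
  by move=> _ [x _ <-] /=; rewrite in_itv/=; have /andP[-> /ltW->] := frac_itv x.
- by exists (`|b| + M0) => x; apply: F_bdd; have /andP[-> /ltW->] := frac_itv x.
(* The integral known to vanish is over []0, 1]], the wanted one over [[0, 1[]. They share the open
   interval, and the two endpoint terms agree because [G 0 = G 1] and the atoms have equal mass. *)
- rewrite Rintegral_circle.
  have -> : \int[mW]_(x in `[0, 1[) (b + G (frac x)) =
            \int[mW]_(x in `[0, 1[) (b + G x).
    by apply: eq_Rintegral => x; rewrite inE/= in_itv/= => /fracE ->.
  have i01 : mW.-integrable `]0, 1] (EFin \o (fun y => b + G y)) by exact: F_int.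
  have ioo : mW.-integrable `]0, 1[ (EFin \o (fun y => b + G y)).
    by apply: integrableS i01 => //; apply: subset_itvl; rewrite bnd_simp.
  have fin1 (x : R) : (mW [set x] < +oo)%E.
    apply: (@le_lt_trans _ _ (mW `]x - 1, x]%classic)); last exact: mW_fin.
    apply: le_measure; rewrite ?inE//.
    by move=> _ -> /=; rewrite in_itv/= lexx andbT ltrBlDr ltrDl.
  have i1 (x : R) : mW.-integrable [set x] (EFin \o (fun y => b + G y)).
    apply: (integrable_bdd _ (fin1 x) (M := `|b + G x|)) => //.
    - exact: measurable_fun_set1.
    - by move=> _ ->.
  have int1 (x : R) : \int[mW]_(y in [set x]) (b + G y) = (b + G x) * fine (mW [set x]).
    transitivity (\int[mW]_(y in [set x]) (cst (b + G x) y)).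
      by apply: eq_Rintegral => y; rewrite inE => ->.
    by rewrite Rintegral_cst.
  move: F0.
  have -> : `]0, 1]%classic = `]0, 1[ `|` [set 1] :> set R.
    by rewrite setUitv1// bnd_simp.
  have -> : `[0, 1[%classic = [set 0] `|` `]0, 1[ :> set R.
    by rewrite setU1itv// bnd_simp.
  rewrite Rintegral_setU; [|exact: measurable_itv|exact: measurable_set1| |]; last 2 first.
  - by rewrite setUitv1// bnd_simp.
  - by apply/disj_setPS => y [/=]; rewrite in_itv/= => /andP[_ +] y1; rewrite y1 ltxx.
  rewrite Rintegral_setU; [|exact: measurable_set1|exact: measurable_itv| |]; last 2 first.
  - rewrite setU1itv ?bnd_simp//.
    apply: (integrable_bdd _ _ (M := `|b| + M0)) => //.
    + apply: (@le_lt_trans _ _ (mW `]-1, 1]%classic)); last exact: mW_fin.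
      by apply: le_measure; rewrite ?inE//; apply: subset_itv; rewrite bnd_simp// ltrN10.
    + apply: measurable_funD => //; apply: measurable_funS G_meas => //.
      by apply: subset_itvl; rewrite bnd_simp.
    + by move=> y; rewrite /= in_itv/= => /andP[y0 /ltW y1]; apply: F_bdd; rewrite y0.
  - by apply/disj_setPS => y [/=] ->; rewrite in_itv/= ltxx.
  by rewrite !int1 G0 G1 mW_set1 addrC.
- by move=> x; exact: cvg_quotient fL.
- have := G_derive; apply: filterS; first exact: (ae_filter_ringOfSetsType leb).
  move=> x Gx x01.
  have /andP[x0 x1] := x01.
  apply: (@near_eq_is_derive _ _ _ (cst b + G)); last first.
    by rewrite -[c * f x]add0r; apply: is_deriveD; exact: Gx.
  near=> y; rewrite /= fracE//.
  by apply/andP; split; [apply: ltW|]; near: y; [exact: lt_nbhsr|exact: lt_nbhsl].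
Unshelve. all: by end_near. Qed.

End eigenfunction.

(** * Products of one-variable functions under product measures *)

Section prod_measure.
Context {R : realType} d (T : measurableType d).

Lemma prod_measure_null n (m : 'I_n -> {finite_measure set T -> \bar R})
    (i : 'I_n) (N : set T) : measurable N -> m i N = 0%E ->
  prod_measure m [set x | N (tnth x i)] = 0%E.
Proof.
move=> mN N0.
have -> : [set x | N (tnth x i)] =
    [set x : n.-tuple T | forall k, (if k == i then N else setT) (tnth x k)].
  apply/seteqP; split => x /=; last by move=> /(_ i); rewrite eqxx.
  by move=> Nx k; case: eqP => [->|].
rewrite (@prod_measureE _ _ _ _ m (fun k => if k == i then N else setT)); last by move=> k; case: ifP.
by rewrite (bigD1 i)//= eqxx N0 mul0e.
Qed.

Lemma measurable_prod_tnth n (g : 'I_n -> T -> R) :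
  (forall k, measurable_fun setT (g k)) ->
  measurable_fun setT (fun x : n.-tuple T => \prod_(k < n) g k (tnth x k)).
Proof.
move=> mg; apply: measurable_prod => k _.
by apply: measurableT_comp => //; exact: measurable_tnth.
Qed.

Lemma bounded_prod_tnth n (g : 'I_n -> T -> R) :
  (forall k, exists M, forall x, `|g k x| <= M) ->
  exists M, forall x : n.-tuple T, `|\prod_(k < n) g k (tnth x k)| <= M.
Proof.
move=> /choice[M gM]; exists (\prod_(k < n) M k) => x.
by rewrite normr_prod; apply: ler_prod => k _; rewrite normr_ge0 gM.
Qed.

Lemma Rintegral_prod_measure n (m : 'I_n -> {finite_measure set T -> \bar R})
    (g : 'I_n -> T -> R) :
  (forall k, measurable_fun setT (g k)) ->
  (forall k, exists M, forall x, `|g k x| <= M) ->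
  \int[prod_measure m]_x (\prod_(k < n) g k (tnth x k)) =
  \prod_(k < n) \int[m k]_x g k x.
Proof.
elim: n m g => [|n IH] m g mg bg.
  rewrite big_ord0; under eq_Rintegral do rewrite big_ord0.
  by rewrite Rintegral_cst//= indicE in_setT mulr1.
pose P (y : n.-tuple T) := \prod_(k < n) g (lift ord0 k) (tnth y k).
have mP : measurable_fun setT P by exact: (@measurable_prod_tnth n (fun k => g (lift ord0 k))).
have [MP PM] : exists M, forall y, `|P y| <= M by exact: (@bounded_prod_tnth n (fun k => g (lift ord0 k))).
have [M0 gM0] := bg ord0.
pose m2 := prod_measure (fun k => m (lift ord0 k)).
pose h (z : T * n.-tuple T) := g ord0 z.1 * P z.2.
have mh : measurable_fun setT h.
  by apply: measurable_funM; apply: measurableT_comp.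
have hfin : ((m ord0 \x m2)%E setT < +oo)%E.
  rewrite -setXTT product_measure1E//.
  by rewrite lte_mul_pinfty// ?fin_num_measure// -ge0_fin_numE// fin_num_measure.
have ih : (m ord0 \x m2)%E.-integrable setT (EFin \o h).
  apply: (integrable_bdd _ hfin (M := M0 * MP)) => // z _.
  by rewrite normrM ler_pM.
have iP : m2.-integrable setT (EFin \o P).
  apply: (integrable_bdd _ _ (M := MP)) => //.
  by rewrite -ge0_fin_numE// fin_num_measure.
have i0 : (m ord0).-integrable setT (EFin \o g ord0).
  apply: (integrable_bdd _ _ (M := M0)) => //.
  by rewrite -ge0_fin_numE// fin_num_measure.
transitivity (Rintegral (m ord0 \x m2)%E setT h).
  have hE z : \prod_(k < n.+1) g k (tnth (tuple_consp z) k) = h z.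
    rewrite big_ord_recl /h /P; congr (_ * _); apply: eq_bigr => k _.
    by rewrite tnthS.
  rewrite /Rintegral; congr fine.
  have := @integral_pushforward _ _ _ _ R (@tuple_consp _ T n) (@measurable_tuple_consp _ T n)
    (m ord0 \x m2)%E setT (fun x => (\prod_(k < n.+1) g k (tnth x k))%:E).
  rewrite preimage_setT => -> //.
  - by apply: eq_integral => z _ /=; rewrite hE.
  - by apply/measurable_EFinP; exact: measurable_prod_tnth.
  - by apply: eq_integrable ih => // z _ /=; rewrite hE.
rewrite /Rintegral -integral12_prod_meas1//.
rewrite big_ord_recl -IH//; last 1 first.
- rewrite -RintegralZr//; congr fine; apply: eq_integral => x _.
  rewrite /fubini_F.
  transitivity (\int[m2]_y ((g ord0 x)%:E * (P y)%:E))%E.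
    by apply: eq_integral => y _; rewrite /h EFinM.
  rewrite integralZl// EFinM; congr (_ * _)%E.
  by rewrite /Rintegral fineK//; exact: integrable_fin_num.
Qed.

End prod_measure.

(** * Closed subspaces, L^2 as an instance, and finite sums *)

Lemma semi_hilbert_on_closed (R : realType) (V : lmodType R) (S S' : set V)
    (B : V -> V -> R) : semi_hilbert_on S B -> S' `<=` S -> S' 0 ->
  (forall a u v, S' u -> S' v -> S' (a *: u + v)) ->
  (forall (u : nat -> V) x, (forall n, S' (u n)) -> S x ->
    B (u n - x) (u n - x) @[n --> \oo] --> 0 -> S' x) ->
  semi_hilbert_on S' B.
Proof.
move=> SB sub S'0 S'P cl; split => //.
- by move=> u v /sub Su /sub Sv; exact: sh_sym SB _ _ _ _.
- by move=> a u v w /sub Su /sub Sv /sub Sw; exact: sh_lin SB _ _ _ _ _ _ _.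
- by move=> u /sub; exact: sh_ge0 SB _.
- move=> u S'u uc.
  have [x Sx ux] := sh_complete SB (fun n => sub _ (S'u n)) uc.
  by exists x => //; exact: cl ux.
Qed.

Section parallelogram.
Context (R : realType) (V : lmodType R) (S : set V) (B : V -> V -> R).
Hypothesis SB : semi_hilbert_on S B.

(** Positivity of the form at [- a *: u + v] bounds the cross term. *)
Lemma sh_le_comb a u v : S u -> S v ->
  B (a *: u + v) (a *: u + v) <= 2 * a ^+ 2 * B u u + 2 * B v v.
Proof.
move=> Su Sv; rewrite (sh_expand SB)//.
have := sh_ge0 SB (shP SB (- a) Su Sv); rewrite (sh_expand SB)//.
by nra.
Qed.

Lemma sh_leD u v w : S u -> S v -> S w ->
  B (u - w) (u - w) <= 2 * B (u - v) (u - v) + 2 * B (v - w) (v - w).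
Proof.
move=> Su Sv Sw; have := sh_le_comb 1 (shB SB Su Sv) (shB SB Sv Sw).
by rewrite scale1r addrA subrK expr1n mulr1.
Qed.

End parallelogram.

Section L2_hilbert.
Context d (T : measurableType d) (R : realType).
Variable mu : {finite_measure set T -> \bar R}.

Definition ip (f g : T -> R) := \int[mu]_x (f x * g x).

Lemma ipC f g : ip f g = ip g f.
Proof. exact: ip_sym. Qed.

Lemma L2_semi_hilbert : semi_hilbert_on [set f | f \in Lfun mu 2%:E] ip.
Proof.
split => /=.
- exact: Lfun2_0.
- by move=> a u v; exact: Lfun2_linear.
- by move=> u v _ _; exact: ip_sym.
- by move=> a u v w; exact: ip_lin.
- by move=> u _; exact: ip_ge0.
- move=> u uL uc; apply: (Lfun2_complete (K := 1)) => // n.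
  by rewrite mul1r; exact: uc.
Qed.

End L2_hilbert.

Lemma cvg_sum_ord (T : Type) (F : set_system T) (FF : Filter F) (R : realType) n
    (f : 'I_n -> T -> R) (l : 'I_n -> R) :
  (forall m, f m t @[t --> F] --> l m) ->
  \sum_(m < n) f m t @[t --> F] --> \sum_(m < n) l m.
Proof.
elim: n f l => [|n IH] f l fl.
  rewrite big_ord0; under eq_fun do rewrite big_ord0.
  exact: cvg_cst.
rewrite big_ord_recl; under eq_fun do rewrite big_ord_recl.
by apply: cvgD; [exact: fl|apply: IH => m; exact: fl].
Qed.

Lemma Rintegral_sum d (T : measurableType d) (R : realType)
    (mu : {measure set T -> \bar R}) (D : set T) (mD : measurable D) n
    (f : 'I_n -> T -> R) : (forall m, mu.-integrable D (EFin \o f m)) ->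
  \int[mu]_(x in D) (\sum_(m < n) f m x) = \sum_(m < n) \int[mu]_(x in D) f m x.
Proof.
move=> fi; rewrite /Rintegral sum_fine => [|m _]; last exact: (integrable_fin_num mD (fi m)).
congr fine; rewrite -(@integral_sum _ _ _ mu D mD _ (fun m x => (f m x)%:E) fi).
by apply: eq_integral => x _; rewrite sumEFin.
Qed.

(** * Derivatives of the test functions *)

Section test_functions.
Context {R : realType} (d : nat).
Variables (W : 'I_d -> cumulative R R) (A : 'I_d -> set (R -> R)).
Hypothesis W_incr : forall (k : 'I_d) (s t : R), s < t -> W k s < W k t.
Hypothesis W_per : forall (k : 'I_d) (s : R), W k (s + 1) - W k s = W k 1 - W k 0.
Hypothesis A_eigen : forall k f, A k f -> exists c : R, LW_graph (W k) f (fun x => c * f x).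

Notation Td := (d.-tuple (measurableTypeR R)).
Implicit Types (f g : Td -> R) (i k : 'I_d) (x : Td).

Lemma tnth_set_coord x i t k :
  tnth (set_coord x i t) k = if k == i then t else tnth x k.
Proof. by rewrite tnth_mktuple. Qed.

Lemma set_coord_tnth x i : set_coord x i (tnth x i) = x.
Proof. by apply: eq_from_tnth => k; rewrite tnth_set_coord; case: eqP => [->|]. Qed.

Lemma prod_set_coord (e : 'I_d -> R -> R) x i t :
  \prod_(k < d) e k (tnth (set_coord x i t) k) =
  (\prod_(k < d | k != i) e k (tnth x k)) * e i t.
Proof.
rewrite (bigD1 i)//= tnth_set_coord eqxx mulrC; congr (_ * _).
by apply: eq_bigr => k /negbTE ki; rewrite tnth_set_coord ki.
Qed.

Lemma DW_prodE f : DW A f -> exists n (c : 'I_n -> R) (e : 'I_n -> 'I_d -> R -> R),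
  (forall m k, A k (e m k)) /\
  forall x, f x = \sum_(m < n) c m * \prod_(k < d) e m k (tnth x k).
Proof.
move=> [n [c [e [eA fE]]]].
(* The [exists2] of [AW] is repacked as an existential over a conjunction, the form that [choice]
   accepts. *)
have [e' e'P] := choice (fun m => let: ex_intro2 e' h1 h2 := eA m in
  ex_intro (fun e' => (forall k, A k (e' k)) /\ forall x, e m x = \prod_(k < d) e' k (tnth x k))
    e' (conj h1 h2)).
exists n, c, e'; split => [m|x]; first by have [] := e'P m.
by rewrite fE; apply: eq_bigr => m _; rewrite (e'P m).2.
Qed.

Lemma DW_linear a f g : DW A f -> DW A g -> DW A (a *: f + g).
Proof.
move=> [n [c [e [eA fE]]]] [n' [c' [e' [e'A gE]]]].
exists (n + n')%N, (fun m : 'I_(n + n') => match fintype.split m with inl j => a * c j | inr j => c' j end),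
  (fun m : 'I_(n + n') => match fintype.split m with inl j => e j | inr j => e' j end); split.
  by move=> m; case: fintype.split.
move=> x; rewrite big_split_ord/= -[LHS]/(a * f x + g x) fE gE mulr_sumr.
by congr (_ + _); apply: eq_bigr => j _;
  [rewrite (unsplitK (inl _ j)) mulrA|rewrite (unsplitK (inr _ j))].
Qed.

Lemma DW0 : DW A 0.
Proof.
exists 0%N, (fun=> 0), (fun _ => 0); split => [[]//|x].
by rewrite big_ord0.
Qed.

Definition wquotient i f x (e : R) :=
  (f (set_coord x i (tnth x i + e)) - f x) / (W i (tnth x i + e) - W i (tnth x i)).

Lemma partialWE i f x : partialW W i f x = lim (wquotient i f x e @[e --> 0^']).
Proof. by rewrite /partialW /gen_derive /wquotient set_coord_tnth. Qed.

Definition eigen_data k (e F : R -> R) (c : R) : Prop :=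
  [/\ measurable_fun setT e /\ (exists M, forall t : R, `|e t| <= M),
      measurable_fun setT F /\ (exists M, forall t : R, `|F t| <= M),
      \int[circle_measure (W k)]_t F t = 0,
      forall t : R, (e (t + s) - e t) / (W k (t + s) - W k t) @[s --> 0^'] --> F t &
      {ae lebesgue_measure, forall t : R, 0 < t < 1 -> is_derive t 1 F (c * e t)}].

Lemma eigen_dataP n (e : 'I_n -> 'I_d -> R -> R) : (forall m k, A k (e m k)) ->
  exists (F : 'I_n -> 'I_d -> R -> R) (c : 'I_n -> 'I_d -> R),
    forall m k, eigen_data k (e m k) (F m k) (c m k).
Proof.
move=> eA.
have H (mk : 'I_n * 'I_d) : exists Fc : (R -> R) * R,
    eigen_data mk.2 (e mk.1 mk.2) Fc.1 Fc.2.
  case: mk => m k /=; have [c ec] := A_eigen (eA m k).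
  have [F [mF bF F0 Fl F']] := eigenfunction_gen_derive (@W_incr k) (@W_per k) ec.
  exists (F, c); split => //; split; first by have [/Lfun2_measurable] := ec.
  exact: eigenfunction_bdd (@W_incr k) _ _ ec.
have [Fc FcP] := choice H.
by exists (fun m k => (Fc (m, k)).1), (fun m k => (Fc (m, k)).2) => m k; exact: (FcP (m, k)).
Qed.

Let bounded_meas (g : Td -> R) := measurable_fun setT g /\ exists M, forall x, `|g x| <= M.

Let bounded_meas_sum n (c : 'I_n -> R) (g : 'I_n -> 'I_d -> R -> R) :
  (forall m k, measurable_fun setT (g m k) /\ exists M, forall t : R, `|g m k t| <= M) ->
  bounded_meas (fun x => \sum_(m < n) c m * \prod_(k < d) g m k (tnth x k)).
Proof.
move=> gP; split.
  apply: measurable_sum => m; apply: measurable_funM => //.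
  by apply: measurable_prod_tnth => k; exact: (gP m k).1.
have H (m : 'I_n) : exists M, forall x : Td, `|\prod_(k < d) g m k (tnth x k)| <= M.
  by apply: bounded_prod_tnth => k; exact: (gP m k).2.
have [M MP] := choice H.
exists (\sum_(m < n) `|c m| * M m) => x.
apply: (le_trans (ler_norm_sum _ _ _)); apply: ler_sum => m _.
by rewrite normrM ler_wpM2l.
Qed.

(** A test function is a finite sum of products, and [partialW i] replaces only the [i]-th factor by
    its [W_i]-derivative. That factor has zero mean, which Fubini passes on to the product;
    differentiating it again gives back the eigenfunction times its eigenvalue. *)
Lemma DW_partial i f : DW A f ->
  [/\ forall x, wquotient i f x e @[e --> 0^'] --> partialW W i f x,
      measurable_fun setT (partialW W i f),
      (exists M, forall x, `|partialW W i f x| <= M),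
      \int[xW W i]_x partialW W i f x = 0 &
      exists L : Td -> R, [/\ measurable_fun setT L, exists M, forall x, `|L x| <= M &
        exists N : set Td, [/\ measurable N, lebTd d N = 0%E &
          forall x, ~ N x -> partialxW W i f x = L x]]].
Proof.
move=> /DW_prodE[n [c [e [eA fE]]]].
have [F [mu FP]] := eigen_dataP eA.
pose Q m x := \prod_(k < d | k != i) e m k (tnth x k).
have fQ x t : f (set_coord x i t) = \sum_(m < n) c m * (Q m x * e m i t).
  by rewrite fE; apply: eq_bigr => m _; rewrite prod_set_coord.
pose e' m k := if k == i then F m k else e m k.
pose D x := \sum_(m < n) c m * \prod_(k < d) e' m k (tnth x k).
have DQ x t : D (set_coord x i t) = \sum_(m < n) c m * (Q m x * F m i t).
  apply: eq_bigr => m _; rewrite prod_set_coord {2}/e' eqxx; congr (_ * (_ * _)).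
  by apply: eq_bigr => k /negbTE ki; rewrite /e' ki.
have qD x : wquotient i f x s @[s --> 0^'] --> D x.
  have fx : f x = \sum_(m < n) c m * (Q m x * e m i (tnth x i)).
    by rewrite -fQ set_coord_tnth.
  have -> : D x = \sum_(m < n) c m * (Q m x * F m i (tnth x i)).
    by rewrite -DQ set_coord_tnth.
  rewrite (_ : wquotient i f x = fun s => \sum_(m < n) c m * (Q m x *
      ((e m i (tnth x i + s) - e m i (tnth x i)) / (W i (tnth x i + s) - W i (tnth x i))))).
    apply: cvg_sum_ord => m; apply: cvgM; first exact: cvg_cst.
    apply: cvgM; first exact: cvg_cst.
    by have [_ _ _] := FP m i.
  apply/funext => s; rewrite /wquotient fQ fx -sumrB mulr_suml.
  by apply: eq_bigr => m _; rewrite -mulrBr -mulrBr !mulrA.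
have pD : partialW W i f = D.
  by apply/funext => x; rewrite partialWE; apply/cvg_lim; [exact: Rhausdorff|exact: qD].
have be' m k : measurable_fun setT (e' m k) /\ exists M, forall t : R, `|e' m k t| <= M.
  by rewrite /e'; have [] := FP m k; case: ifP.
have [mD bD] : bounded_meas D.
  by apply: bounded_meas_sum.
rewrite pD; split => //.
- have iP m : (xW W i).-integrable setT
      (EFin \o (fun x => \prod_(k < d) e' m k (tnth x k))).
    have [M PM] : exists M, forall x : Td, `|\prod_(k < d) e' m k (tnth x k)| <= M.
      by apply: bounded_prod_tnth => k; exact: (be' m k).2.
    apply: (integrable_bdd _ _ (M := M)) => //.
      by rewrite -ge0_fin_numE// fin_num_measure.
    by apply: measurable_prod_tnth => k; exact: (be' m k).1.
  rewrite /D.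
  transitivity (\sum_(m < n) c m * \int[xW W i]_x \prod_(k < d) e' m k (tnth x k)).
    rewrite Rintegral_sum//; last by move=> m; exact: integrableZl_EFin.
    by apply: eq_bigr => m _; rewrite RintegralZl.
  apply: big1 => m _; rewrite Rintegral_prod_measure//; last 2 first.
  + by move=> k; exact: (be' m k).1.
  + by move=> k; exact: (be' m k).2.
  rewrite (bigD1 i)//= /e' eqxx; have [_ _ -> _ _] := FP m i.
  by rewrite mul0r mulr0.
- pose L x := \sum_(m < n) (c m * mu m i) * \prod_(k < d) e m k (tnth x k).
  have [mL bL] : bounded_meas L.
    by apply: bounded_meas_sum => m k; have [] := FP m k.
  exists L; split => //.
  have : {ae lebesgue_measure, forall t : R, forall m, 0 < t < 1 ->
      is_derive t 1 (F m i) (mu m i * e m i t)}.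
    apply: (@filter_forall R 'I_n
      (fun m t => 0 < t < 1 -> is_derive t 1 (F m i) (mu m i * e m i t))
      _ (ae_filter_ringOfSetsType (@lebesgue_measure R))) => m.
    by have [_ _ _ _ ] := FP m i.
  move=> [N [mN N0 NP]].
  (* The derivative of [F m i] is known only inside []0, 1[]; on the torus, discarding the rest
     costs only the Lebesgue-null point 0. *)
  pose N' := N `|` ~` (`]0, 1[ : set R).
  have mN' : measurable N' by apply: measurableU => //; exact: measurableC.
  exists [set x | N' (tnth x i)]; split.
  + rewrite -[X in measurable X]setTI; exact: (measurable_tnth i measurableT).
  + apply: prod_measure_null => //.
    apply/eqP; rewrite eq_le measure_ge0 andbT.
    rewrite /= /circle_measure /mrestr.
    apply: (@le_trans _ _ (lebesgue_measure (N `|` [set 0]))).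
      apply: le_measure; rewrite ?inE.
      * exact: measurableI.
      * exact: measurableU.
      * move=> t [[Nt|/= t01] /=]; first by left.
        rewrite in_itv/= => /andP[t0 t1]; right; apply: contrapT => /eqP tn0.
        by apply: t01; rewrite in_itv/= t1 lt_neqAle eq_sym tn0 t0.
    have : (lebesgue_measure (N `|` [set 0%R]) <=
        lebesgue_measure N + lebesgue_measure [set 0%R : R])%E by exact: measureU2.
    by move/le_trans; apply; rewrite N0 add0e lebesgue_measure_set1.
  + move=> x /not_orP[Nx /contrapT /=]; rewrite in_itv/= => x01.
    have Fd m : is_derive (tnth x i) 1 (F m i) (mu m i * e m i (tnth x i)).
      by apply: contrapT => h; apply/Nx/NP => /(_ m x01).
    have De : (fun t => partialW W i f (set_coord x i t)) =
        \sum_(m < n) (c m * Q m x) \*: F m i.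
      apply/funext => t; rewrite pD DQ fct_sumE.
      by apply: eq_bigr => m _; rewrite mulrA.
    rewrite /partialxW De derive1E.
    have := @is_derive_sum _ _ _ n (fun m => (c m * Q m x) \*: F m i) (tnth x i) 1
      (fun m => (c m * Q m x) *: (mu m i * e m i (tnth x i)))
      (fun m => is_deriveZ _ (Fd m)).
    move=> /@derive_val ->; apply: eq_bigr => m _.
    have := prod_set_coord (e m) x i (tnth x i); rewrite set_coord_tnth => ->.
    by rewrite -/(Q m x) -[_ *: _]/(_ * _); ring.
Qed.

End test_functions.

(** * The closure of the test derivatives and the weak identity *)

Section weak_derivative.
Context {R : realType} (d : nat).
Variables (W : 'I_d -> cumulative R R) (A : 'I_d -> set (R -> R)).
Hypothesis W_incr : forall (k : 'I_d) (s t : R), s < t -> W k s < W k t.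
Hypothesis W_per : forall (k : 'I_d) (s : R), W k (s + 1) - W k s = W k 1 - W k 0.
Hypothesis A_eigen : forall k f, A k f -> exists c : R, LW_graph (W k) f (fun x => c * f x).

Notation Td := (d.-tuple (measurableTypeR R)).
Implicit Types (f g G H : Td -> R) (i k : 'I_d) (x : Td).
Local Notation ipW i := (ip (xW W i)).
Local Notation ipT := (ip (lebTd d)).

Let DWp i f := @DW_partial R d W A W_incr W_per A_eigen i f.

Lemma partialW_Lfun i f : DW A f -> partialW W i f \in Lfun (xW W i) 2%:E.
Proof. by move=> /(DWp i)[_ mf [M fM] _ _]; exact: Lfun2_bdd fM. Qed.

Lemma partialW_linear i a f g : DW A f -> DW A g ->
  partialW W i (a *: f + g) = a *: partialW W i f + partialW W i g.
Proof.
move=> /(DWp i)[cf _ _ _ _] /(DWp i)[cg _ _ _ _]; apply/funext => x.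
rewrite partialWE; apply/cvg_lim; first exact: Rhausdorff.
rewrite (_ : wquotient W i (a *: f + g) x =
    fun e => a * wquotient W i f x e + wquotient W i g x e).
  by apply: cvgD; [apply: cvgM; [exact: cvg_cst|exact: cf]|exact: cg].
apply/funext => e; rewrite /wquotient mulrA -mulrDl; congr (_ / _).
by rewrite -[(a *: f + g) _]/(a * f _ + g _) -[(a *: f + g) x]/(a * f x + g x); ring.
Qed.

Definition W_closure i : set (Td -> R) :=
  [set G | G \in Lfun (xW W i) 2%:E /\ in_closure_partialW W A i G].

Lemma in_W_closureP i G : G \in Lfun (xW W i) 2%:E ->
  in_closure_partialW W A i G <->
  forall eps : R, 0 < eps -> exists2 f, DW A f &
    ipW i (G - partialW W i f) (G - partialW W i f) < eps.
Proof.
move=> GL; have NE f : DW A f -> ('N[xW W i]_2%:E[EFin \o (G \- partialW W i f)%R] =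
    (Num.sqrt (ipW i (G - partialW W i f) (G - partialW W i f)))%:E)%E.
  by move=> fD; rewrite Lfun2_Lnorm//; apply: Lfun2B => //; exact: partialW_Lfun.
split => cl eps eps0.
  have [|f fD] := cl (Num.sqrt eps); first by rewrite sqrtr_gt0.
  by rewrite NE// lte_fin ltr_sqrt// => ?; exists f.
have [|f fD fe] := cl (eps ^+ 2); first by rewrite exprn_gt0.
exists f => //; rewrite NE// lte_fin -[ltRHS]ger0_norm ?(ltW eps0)// -sqrtr_sqr.
by rewrite ltr_sqrt// exprn_gt0.
Qed.

Let L2W i := @L2_semi_hilbert _ Td R (xW W i).
Let L2T := @L2_semi_hilbert _ Td R (lebTd d).

Lemma W_closure_partialW i f : DW A f -> W_closure i (partialW W i f).
Proof.
move=> fD; have fL := partialW_Lfun i fD; split => //.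
apply/in_W_closureP => // eps eps0; exists f => //.
rewrite subrr (_ : ip _ 0 0 = 0)//.
have := shBZ (L2W i) 0 (sh0 (L2W i)).
by rewrite scaler0 expr0n/= mul0r.
Qed.

Lemma W_closure_closed i (u : nat -> Td -> R) G : (forall n, W_closure i (u n)) ->
  G \in Lfun (xW W i) 2%:E ->
  ipW i (u n - G) (u n - G) @[n --> \oo] --> 0 -> W_closure i G.
Proof.
move=> uc GL uG; split => //.
apply/in_W_closureP => // eps eps0.
have e4 : 0 < eps / 4 by rewrite divr_gt0.
have /cvgrPdist_lt/(_ _ e4)[n _ /(_ n (leqnn n)) un] := uG.
have [unL unc] := uc n.
have [f fD fe] := (in_W_closureP unL).1 unc _ e4.
exists f => //.
have fL := partialW_Lfun i fD.
apply: (le_lt_trans (sh_leD (L2W i) GL unL fL)).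
move: un; rewrite sub0r normrN ger0_norm; last exact: ip_ge0.
rewrite -[X in ipW i X X]opprB -[- _]scaleN1r (shBZ (L2W i))//; last exact: Lfun2B.
by move: fe; set X := ip _ _ _; set Y := ip _ _ _; rewrite sqrrN expr1n; lra.
Qed.

Lemma W_closure_hilbert i : semi_hilbert_on (W_closure i) (ipW i).
Proof.
apply: (semi_hilbert_on_closed (L2W i)).
- by move=> G [].
- split; first exact: Lfun2_0.
  have := W_closure_partialW i (DW0 A); rewrite (_ : partialW W i 0 = 0); first by case.
  have := partialW_linear i (-1) (DW0 A) (DW0 A).
  by rewrite scaler0 addr0 => ->; rewrite scaleN1r addNr.
- move=> a G H [GL Gc] [HL Hc]; split; first exact: Lfun2_linear.
  apply/in_W_closureP; first exact: Lfun2_linear.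
  move=> eps eps0.
  (* [sh_le_comb] multiplies this error by [2 * a ^+ 2]; the added 1 allows [a = 0]. *)
  have [|f fD fe] := (in_W_closureP GL).1 Gc (eps / (4 * (a ^+ 2 + 1))).
    by rewrite divr_gt0// mulr_gt0// ltr_wpDl// sqr_ge0.
  have [|g gD ge] := (in_W_closureP HL).1 Hc (eps / 4); first by rewrite divr_gt0.
  exists (a *: f + g); first exact: DW_linear.
  rewrite partialW_linear// (_ : _ - _ = a *: (G - partialW W i f) + (H - partialW W i g)); last first.
    by rewrite scalerBr opprD addrACA.
  have fL := partialW_Lfun i fD; have gL := partialW_Lfun i gD.
  apply: (le_lt_trans (sh_le_comb (L2W i) a (Lfun2B GL fL) (Lfun2B HL gL))).
  have a1 : 0 < a ^+ 2 + 1 by rewrite ltr_wpDl// sqr_ge0.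
  rewrite ltr_pdivlMr in fe; last by rewrite mulr_gt0.
  have := sh_ge0 (L2W i) (Lfun2B GL fL).
  have := sqr_ge0 a; set X := ip _ _ _ in fe *; set Y := ip _ _ _ in ge *.
  move=> a0 X0; nra.
- by move=> u G uc GL uG; exact: (W_closure_closed uc GL uG).
Qed.

(** The mean is the inner product with the constant 1, hence continuous, and it vanishes on test
    derivatives. *)
Lemma W_closure_mean0 i G : W_closure i G -> \int[xW W i]_x G x = 0.
Proof.
move=> [GL Gc].
have oL : (cst 1 : Td -> R) \in Lfun (xW W i) 2%:E by exact: Lfun_cst.
have ip1 H : ipW i H (cst 1) = \int[xW W i]_x H x.
  by apply: eq_Rintegral => x _; rewrite mulr1.
rewrite -ip1; apply/eqP; rewrite -sqrf_eq0 eq_le sqr_ge0 andbT.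
apply/ler_addgt0Pr => eps eps0; rewrite add0r.
set K := ipW i (cst 1) (cst 1) + 1.
have K0 : 0 < K by rewrite /K ltr_wpDl// ip_ge0.
have [|f fD fe] := (in_W_closureP GL).1 Gc (eps / K); first by rewrite divr_gt0.
have fL := partialW_Lfun i fD.
have -> : ipW i G (cst 1) = ipW i (G - partialW W i f) (cst 1).
  rewrite addrC -scaleN1r (sh_lin (L2W i))// [X in -1 * X](_ : _ = 0) ?mulr0 ?add0r//.
  by rewrite ip1; have [] := DWp i fD.
apply: (le_trans (sh_cauchy_schwarz (L2W i) (Lfun2B GL fL) oL)).
apply: (@le_trans _ _ (eps / K * K)); last by rewrite divfK// gt_eqF.
apply: ler_pM => //; [exact: ip_ge0|exact: ip_ge0|exact: ltW|].
by rewrite /K lerDl.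
Qed.

(** The Riesz representative of [v |-> <G, v>] on the closure is the orthogonal projection of
    [G]. *)
Lemma W_closure_proj i G : G \in Lfun (xW W i) 2%:E ->
  exists2 H, W_closure i H & forall f, DW A f ->
    ipW i (partialW W i f) H = ipW i (partialW W i f) G.
Proof.
move=> GL.
have [H HK HG] : exists2 H, W_closure i H & forall v, W_closure i v -> ipW i H v = ipW i G v.
  apply: (riesz_on (W_closure_hilbert i) (C := ipW i G G)).
  - exact: ip_ge0.
  - by move=> a u v [uL _] [vL _]; rewrite (sh_linr (L2W i)).
  - by move=> v [vL _]; exact: (sh_cauchy_schwarz (L2W i)).
exists H => // f /(W_closure_partialW i) fK.
by rewrite [LHS]ipC [RHS]ipC; exact: HG.
Qed.

(** Subtracting a close test derivative does not change the product with [G], so Cauchy-Schwarz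
    bounds <G, G> by the squared distance to that derivative, which is arbitrarily small. *)
Lemma W_closure_orth0 i G : W_closure i G ->
  (forall f, DW A f -> ipW i (partialW W i f) G = 0) -> G = 0 %[ae xW W i].
Proof.
move=> [GL Gc] G0; apply: ip_eq0_ae => //.
have GG0 : 0 <= ipW i G G by exact: ip_ge0.
apply/eqP; rewrite eq_le GG0 andbT.
apply/ler_addgt0Pr => eps eps0; rewrite add0r.
have [f fD fe] := (in_W_closureP GL).1 Gc eps eps0.
have fL := partialW_Lfun i fD.
have GE : ipW i G G = ipW i (G - partialW W i f) G.
  by rewrite [in RHS]addrC -scaleN1r (sh_lin (L2W i))// G0// mulr0 add0r.
have := sh_cauchy_schwarz (L2W i) (Lfun2B GL fL) GL; rewrite -GE.
have := sh_ge0 (L2W i) (Lfun2B GL fL).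
rewrite /ip in fe GG0 *.
move: fe GG0; set X := Rintegral _ _ _; set Y := Rintegral _ _ _ => Xe Y0 X0 YX.
have [->|Yn0] := eqVneq Y 0; first exact: ltW.
have Yp : 0 < Y by rewrite lt_neqAle eq_sym Yn0.
by rewrite expr2 ler_pM2r// in YX; exact: le_trans (ltW Xe).
Qed.

Let test_Laplacian i f : DW A f -> exists2 L, L \in Lfun (lebTd d) 2%:E &
  forall g, \int[lebTd d]_x (partialxW W i f x * g x) = ipT L g.
Proof.
move=> /(DWp i)[_ _ _ _ [L [mL [M LM] [N [mN N0 NL]]]]].
exists L; first exact: Lfun2_bdd LM.
by move=> g; apply: (eq_Rintegral_off_null mN N0) => x /NL ->.
Qed.

Lemma weak_partialW_linear i a g g' G G' :
  g \in Lfun (lebTd d) 2%:E -> g' \in Lfun (lebTd d) 2%:E ->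
  G \in Lfun (xW W i) 2%:E -> G' \in Lfun (xW W i) 2%:E ->
  (forall f, DW A f -> \int[lebTd d]_x (partialxW W i f x * g x) =
                     - ipW i (partialW W i f) G) ->
  (forall f, DW A f -> \int[lebTd d]_x (partialxW W i f x * g' x) =
                     - ipW i (partialW W i f) G') ->
  forall f, DW A f -> \int[lebTd d]_x (partialxW W i f x * (a *: g + g') x) =
                     - ipW i (partialW W i f) (a *: G + G').
Proof.
move=> gL g'L GL G'L gG g'G f fD.
have fL := partialW_Lfun i fD.
have [L LL LE] := test_Laplacian i fD.
rewrite LE (sh_linr L2T a gL g'L LL) (sh_linr (L2W i) a GL G'L fL).
by rewrite -(LE g) -(LE g') (gG f fD) (g'G f fD) mulrN -opprD.
Qed.

Lemma weak_partialW_closed i (g : nat -> Td -> R) (G : nat -> Td -> R) g' G' :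
  (forall n, g n \in Lfun (lebTd d) 2%:E) -> g' \in Lfun (lebTd d) 2%:E ->
  (forall n, G n \in Lfun (xW W i) 2%:E) -> G' \in Lfun (xW W i) 2%:E ->
  (forall n f, DW A f -> \int[lebTd d]_x (partialxW W i f x * g n x) =
                     - ipW i (partialW W i f) (G n)) ->
  ipT (g n - g') (g n - g') @[n --> \oo] --> 0 ->
  ipW i (G n - G') (G n - G') @[n --> \oo] --> 0 ->
  forall f, DW A f -> \int[lebTd d]_x (partialxW W i f x * g' x) =
                     - ipW i (partialW W i f) G'.
Proof.
move=> gL g'L GL G'L gG cg cG f fD.
have fL := partialW_Lfun i fD.
have [L LL LE] := test_Laplacian i fD.
have c1 := sh_cvg L2T gL g'L LL cg.
have c2 := sh_cvg (L2W i) GL G'L fL cG.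
rewrite LE [ip _ L g']ipC [ip _ (partialW W i f) G']ipC.
have c3 : ipT (g n) L @[n --> \oo] --> - ipW i G' (partialW W i f).
  rewrite (_ : (fun n => _) = fun n => - ipW i (G n) (partialW W i f)).
    by apply: cvgN; exact: c2.
  by apply/funext => n; rewrite ipC -LE gG// [X in - X]ipC.
by rewrite -(cvg_unique _ c1 c3).
Qed.

End weak_derivative.

(** * The energy space of pairs *)

Section energy_space.
Context {R : realType} (d : nat).
Variables (W : 'I_d -> cumulative R R) (A : 'I_d -> set (R -> R)).
Hypothesis W_incr : forall (k : 'I_d) (s t : R), s < t -> W k s < W k t.
Hypothesis W_per : forall (k : 'I_d) (s : R), W k (s + 1) - W k s = W k 1 - W k 0.
Hypothesis A_eigen : forall k f, A k f -> exists c : R, LW_graph (W k) f (fun x => c * f x).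

Notation Td := (d.-tuple (measurableTypeR R)).
Implicit Types (f g G H : Td -> R) (i k : 'I_d) (x : Td).
Local Notation ipW i := (ip (xW W i)).
Local Notation ipT := (ip (lebTd d)).

Let L2W i := @L2_semi_hilbert _ Td R (xW W i).
Let L2T := @L2_semi_hilbert _ Td R (lebTd d).

Definition weak_identity i g G := forall f, DW A f ->
  \int[lebTd d]_x (partialxW W i f x * g x) = - ipW i (partialW W i f) G.

(** The choice made by [xget] is meaningful once one candidate exists: the projection of any weak
    derivative of [g]. *)
Lemma partialH_spec i g : H1W W A g ->
  W_closure W A i (partialH W A i g) /\ weak_identity i g (partialH W A i g).
Proof.
move=> [gL /(_ i)[G [/set_mem[GL G0] gG]]].
have [H [HL Hc] HG] := W_closure_proj W_incr W_per A_eigen GL.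
have : [set G' | weak_partialW W A i g G' /\ in_closure_partialW W A i G'] (partialH W A i g).
  apply: xgetPex; exists H; split => //; split.
    apply: mem_set; split => //; exact: (W_closure_mean0 W_incr W_per A_eigen (conj HL Hc)).
  by move=> f fD; rewrite gG//; congr (- _); exact/esym/HG.
by move=> [[/set_mem[pL p0] pw] pc]; split; [split|exact: pw].
Qed.

Lemma partialH_unique i g G : H1W W A g -> W_closure W A i G -> weak_identity i g G ->
  partialH W A i g = G %[ae xW W i].
Proof.
move=> gH GK Gw; have [pK pw] := partialH_spec i gH.
have SK := W_closure_hilbert W_incr W_per A_eigen i.
have : partialH W A i g - G = 0 %[ae xW W i].
  apply: (W_closure_orth0 W_incr W_per A_eigen (shB SK pK GK)) => f fD; rewrite addrC -scaleN1r.
  rewrite (sh_linr (L2W i) _ GK.1 pK.1 (partialW_Lfun W_incr W_per A_eigen i fD)).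
  by have := Gw f fD; rewrite (pw f fD) => /oppr_inj ->; rewrite mulN1r addNr.
apply: filterS => x /(_ I) h0 _; apply/eqP; rewrite -subr_eq0; exact/eqP.
Qed.

Variables (lambda : R) (lambda_gt0 : 0 < lambda).
Variables (b : 'I_d -> Td -> R) (m M : R) (m_gt0 : 0 < m).
Hypothesis b_meas : forall i, measurable_fun setT (b i).
Hypothesis b_ge : forall i x, m <= b i x.
Hypothesis b_le : forall i x, b i x <= M.

Let ipb i G H := ipW i (fun x => b i x * G x) H.

Let bM i x : `|b i x| <= M.
Proof. by rewrite ger0_norm// (le_trans (ltW m_gt0)). Qed.

Let bL i G : G \in Lfun (xW W i) 2%:E -> (fun x => b i x * G x) \in Lfun (xW W i) 2%:E.
Proof. by move=> GL; exact: Lfun2_bddM (bM i) GL. Qed.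

Let ipb_sym i G H : ipb i G H = ipb i H G.
Proof. by apply: eq_Rintegral => x _; rewrite mulrAC -mulrA. Qed.

Let ipb_lin i a G G' H : G \in Lfun (xW W i) 2%:E -> G' \in Lfun (xW W i) 2%:E ->
  H \in Lfun (xW W i) 2%:E -> ipb i (a *: G + G') H = a * ipb i G H + ipb i G' H.
Proof.
move=> GL G'L HL; rewrite -(sh_lin (L2W i)) ?/=; [|exact: bL..|exact: HL].
apply: eq_Rintegral => x _; congr (_ * _).
rewrite -[(a *: G + G') x]/(a * G x + G' x).
by rewrite -[RHS]/(a * (b i x * G x) + b i x * G' x); ring.
Qed.

Let ipb_ge i G : G \in Lfun (xW W i) 2%:E -> m * ipW i G G <= ipb i G G.
Proof.
move=> GL; rewrite -RintegralZl//; last exact: Lfun2_integrableM.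
apply: le_Rintegral => //.
- by apply: integrableZl_EFin => //; exact: Lfun2_integrableM.
- by apply: Lfun2_integrableM => //; exact: bL.
- by move=> x _; rewrite -mulrA ler_wpM2r// -expr2 sqr_ge0.
Qed.

Let ipb_le i G : G \in Lfun (xW W i) 2%:E -> ipb i G G <= M * ipW i G G.
Proof.
move=> GL; rewrite -RintegralZl//; last exact: Lfun2_integrableM.
apply: le_Rintegral => //.
- by apply: Lfun2_integrableM => //; exact: bL.
- by apply: integrableZl_EFin => //; exact: Lfun2_integrableM.
- by move=> x _; rewrite -mulrA ler_wpM2r// -expr2 sqr_ge0.
Qed.

Let ipb_ge0 i G : G \in Lfun (xW W i) 2%:E -> 0 <= ipb i G G.
Proof.
by move=> GL; apply: le_trans (ipb_ge GL); rewrite mulr_ge0 ?(ltW m_gt0)//; exact: ip_ge0.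
Qed.

Local Notation V := ((Td -> R) * ('I_d -> Td -> R))%type.

(* The energy is bilinear on these pairs, whereas [partialH] is linear in its
   argument only almost everywhere. *)
Definition W_graph : set V := [set p | p.1 \in Lfun (lebTd d) 2%:E /\
  forall i, W_closure W A i (p.2 i) /\ weak_identity i p.1 (p.2 i)].

Definition energy (p q : V) : R :=
  lambda * ipT p.1 q.1 + \sum_(i < d) ipW i (fun x => b i x * p.2 i x) (q.2 i).

Lemma W_graph_H1W g (G : 'I_d -> Td -> R) : W_graph (g, G) -> H1W W A g.
Proof.
move=> [/= gL gG]; split => // i; exists (G i); have [[GL Gc] Gw] := gG i.
split => //; apply: mem_set; split => //; exact: (W_closure_mean0 W_incr W_per A_eigen (conj GL Gc)).
Qed.

Lemma H1W_W_graph g : H1W W A g -> W_graph (g, fun i => partialH W A i g).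
Proof. by move=> gH; split => [|i] /=; [case: gH|exact: partialH_spec]. Qed.

Lemma energy_ge p : W_graph p ->
  lambda * ipT p.1 p.1 + m * \sum_(i < d) ipW i (p.2 i) (p.2 i) <= energy p p.
Proof.
move=> [gL gG]; rewrite lerD2l mulr_sumr; apply: ler_sum => i _.
by apply: ipb_ge; have [[]] := gG i.
Qed.

Let W_graph_linear a p q : W_graph p -> W_graph q -> W_graph (a *: p + q).
Proof.
case: p q => [g G] [g' G'] [/= gL gG] [/= g'L g'G].
rewrite (_ : a *: (g, G) + (g', G') = (a *: g + g', fun i => a *: G i + G' i))//.
split => [|i] /=; first exact: Lfun2_linear.
have [GK Gw] := gG i; have [G'K G'w] := g'G i; split.
  exact: (shP (W_closure_hilbert W_incr W_per A_eigen i) a GK G'K).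
exact: (weak_partialW_linear W_incr W_per A_eigen a gL g'L GK.1 G'K.1 Gw G'w).
Qed.

(** The lower bounds [lambda] and [m] make every component of an energy-Cauchy sequence L^2-Cauchy,
    with the constants [lambda^-1] and [m^-1]. The weak identity survives the limits, and the upper
    bound [M] turns L^2 convergence back into energy convergence. *)
Lemma energy_hilbert : semi_hilbert_on W_graph energy.
Proof.
split.
- split => [|i] /=; first exact: Lfun2_0.
  split; first exact: (sh0 (W_closure_hilbert W_incr W_per A_eigen i)).
  move=> f fD; rewrite /ip /Rintegral !integral0_eq ?oppr0// => x _; by rewrite mulr0.
- exact: W_graph_linear.
- move=> p q _ _; rewrite /energy ipC; congr (_ + _).
  by apply: eq_bigr => i _; exact: ipb_sym.
- move=> a p q r [pL pG] [qL qG] [rL rG].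
  rewrite /energy (sh_lin L2T)// mulrDr mulrDr addrACA mulrCA; congr (_ + _).
  rewrite mulr_sumr -big_split/=; apply: eq_bigr => i _.
  by apply: ipb_lin; [have [[]] := pG i|have [[]] := qG i|have [[]] := rG i].
- move=> p pG; apply: le_trans (energy_ge pG).
  rewrite addr_ge0// mulr_ge0 ?(ltW lambda_gt0) ?(ltW m_gt0)//; first exact: ip_ge0.
  by apply: sumr_ge0 => i _; exact: ip_ge0.
- move=> u uG uc.
  have duG n : W_graph (u n.+1 - u n).
    by rewrite addrC -scaleN1r; exact: W_graph_linear.
  have [g gL ug] : exists2 g, g \in Lfun (lebTd d) 2%:E &
      ipT ((u n).1 - g) ((u n).1 - g) @[n --> \oo] --> 0.
    apply: (Lfun2_complete (K := lambda^-1)); first by move=> n; have [] := uG n.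
    move=> n; rewrite mulrC ler_pdivlMr// mulrC.
    apply: le_trans (uc n); apply: le_trans (energy_ge (duG n)).
    rewrite lerDl mulr_ge0 ?(ltW m_gt0)//.
    by apply: sumr_ge0 => i _; exact: ip_ge0.
  have HG i : exists G, G \in Lfun (xW W i) 2%:E /\
      ipW i ((u n).2 i - G) ((u n).2 i - G) @[n --> \oo] --> 0.
    have [G GL uGi] : exists2 G, G \in Lfun (xW W i) 2%:E &
        ipW i ((u n).2 i - G) ((u n).2 i - G) @[n --> \oo] --> 0.
      apply: (Lfun2_complete (K := m^-1)); first by move=> n; have [_ /(_ i)[[]]] := uG n.
      move=> n; rewrite mulrC ler_pdivlMr// mulrC.
      apply: le_trans (uc n); apply: le_trans (energy_ge (duG n)).
      rewrite (bigD1 i)//= mulrDr addrCA lerDl addr_ge0//.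
        by rewrite mulr_ge0 ?(ltW lambda_gt0)//; exact: ip_ge0.
      rewrite mulr_ge0 ?(ltW m_gt0)//.
      by apply: sumr_ge0 => j _; exact: ip_ge0.
    by exists G.
  have [G GP] := choice HG.
  exists (g, G).
    split=> [//|i]; have [GL uGi] := GP i; split.
      by apply: (W_closure_closed W_incr W_per A_eigen _ GL uGi) => n; have [_ /(_ i)[]] := uG n.
    apply: (weak_partialW_closed W_incr W_per A_eigen _ gL _ GL _ ug uGi).
    + by move=> n; have [] := uG n.
    + by move=> n; have [_ /(_ i)[[]]] := uG n.
    + by move=> n; have [_ /(_ i)[]] := uG n.
  have -> : 0 = lambda * 0 + \sum_(i < d) 0 :> R by rewrite big1// mulr0 addr0.
  apply: cvgD.
    by apply: cvgM; [exact: cvg_cst|exact: ug].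
  apply: cvg_sum_ord => i; have [GL uGi] := GP i.
  have unL n : (u n).2 i - G i \in Lfun (xW W i) 2%:E.
    by have [_ /(_ i)[[unL _] _]] := uG n; exact: Lfun2B unL GL.
  apply: (@squeeze_cvgr _ _ _ _ (cst 0) (fun n => M * ipW i ((u n).2 i - G i) ((u n).2 i - G i))).
  + apply: nearW => n /=; apply/andP; split; first exact: ipb_ge0 (unL n).
    exact: ipb_le (unL n).
  + exact: cvg_cst.
  + rewrite -[X in _ --> X](mulr0 M); apply: cvgM; first exact: cvg_cst.
    exact: uGi.
Qed.

Lemma energy_riesz f : f \in Lfun (lebTd d) 2%:E ->
  exists2 p, W_graph p & forall q, W_graph q -> energy p q = ipT f q.1.
Proof.
(* Cauchy-Schwarz bounds <f, q.1>^2 by <f, f> <q.1, q.1>, and the energy dominates [lambda] times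
   the last factor. *)
move=> fL; apply: (riesz_on energy_hilbert (C := ipT f f * lambda^-1)).
- by rewrite mulr_ge0 ?invr_ge0 ?(ltW lambda_gt0)//; exact: ip_ge0.
- by move=> a p q [pL _] [qL _]; exact: (sh_linr L2T).
- move=> q qG; have [qL _] := qG.
  apply: (le_trans (sh_cauchy_schwarz L2T fL qL)).
  rewrite -mulrA ler_wpM2l//; first exact: ip_ge0.
  rewrite mulrC ler_pdivlMr// mulrC; apply: le_trans (energy_ge qG).
  rewrite lerDl mulr_ge0 ?(ltW m_gt0)//.
  by apply: sumr_ge0 => i _; exact: ip_ge0.
Qed.

End energy_space.

(** * Existence, uniqueness and the two bounds *)

Lemma ae_cube (R : realType) (d : nat) (W : 'I_d -> cumulative R R) (i : 'I_d) :
  {ae xW W i, forall x : d.-tuple (measurableTypeR R), forall k, 0 <= tnth x k < 1}.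
Proof.
apply: (@filter_forall _ 'I_d (fun k x => is_true (0 <= tnth x k < 1))
  _ (ae_filter_ringOfSetsType (xW W i))) => k.
have mC : measurable (~` `[0, 1[ : set R) by exact: measurableC.
exists [set x : d.-tuple (measurableTypeR R) | (~` `[0, 1[ : set R) (tnth x k)]; split.
- rewrite -[X in measurable X]setTI; exact: (measurable_tnth k measurableT).
- apply: prod_measure_null => //.
  by rewrite /= /circle_measure /mrestr setICl measure0.
- by move=> x /=; rewrite in_itv/=.
Qed.

Unset Implicit Arguments.

Theorem proposition3p4 (R : realType) (d : nat) (hd : (0 < d)%N)
  (W : 'I_d -> cumulative R R)
  (W_incr : forall (k : 'I_d) (s t : R), s < t -> W k s < W k t)
  (W_per : forall (k : 'I_d) (s : R), W k (s + 1) - W k s = W k 1 - W k 0)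
  (A : 'I_d -> set (R -> R))
  (A_basis : forall k : 'I_d, eigenbasis (W k) (A k))
  (a : 'I_d -> d.-tuple (measurableTypeR R) -> R)
  (a_meas : forall i : 'I_d, measurable_fun setT (a i))
  (theta : R) (theta_gt0 : 0 < theta)
  (a_bounds : forall (i : 'I_d) (x : d.-tuple (measurableTypeR R)),
     (forall k : 'I_d, 0 <= tnth x k < 1) -> theta^-1 <= a i x <= theta)
  (lambda : R) (lambda_gt0 : 0 < lambda) :
  exists2 C : R, 0 < C &
    forall f : d.-tuple (measurableTypeR R) -> R,
      f \in Lfun (lebTd d) 2%:E ->
      exists u : d.-tuple (measurableTypeR R) -> R,
        [/\ weak_solution W A lambda a f u,
            forall u' : d.-tuple (measurableTypeR R) -> R,
              weak_solution W A lambda a f u' -> u' = u %[ae lebTd d],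
            norm1W W A u <= C * fine 'N[lebTd d]_2%:E[EFin \o f] &
            fine 'N[lebTd d]_2%:E[EFin \o u] <=
              lambda^-1 * fine 'N[lebTd d]_2%:E[EFin \o f]].
Proof.
have A_eigen k e : A k e -> exists c : R, LW_graph (W k) e (fun x => c * e x).
  by move=> Ae; have [_ H _ _ _] := A_basis k; exact: H.
pose m := theta^-1; have m_gt0 : 0 < m by rewrite invr_gt0.
pose M := Num.max m theta.
(* The bounds on [a] hold on the torus only; [b] extends them everywhere. *)
pose b i x := Num.max m (Num.min theta (a i x)).
have b_meas i : measurable_fun setT (b i).
  by apply: measurable_maxr => //; apply: measurable_minr.
have b_ge i x : m <= b i x by rewrite le_max lexx.
have b_le i x : b i x <= M.
  rewrite /b /M ge_max; apply/andP; split; first by rewrite le_max lexx.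
  by apply: (@le_trans _ _ theta); [rewrite ge_min lexx|rewrite le_max lexx orbT].
have abE i : {ae xW W i, forall x, a i x = b i x}.
  have := @ae_cube R d W i; apply: filterS => x /(a_bounds i)/andP[ma aM].
  by rewrite /b min_r// max_r.
pose E := energy W lambda b.
pose G := W_graph W A.
have EH : semi_hilbert_on G E.
  exact: (energy_hilbert W_incr W_per A_eigen lambda_gt0 m_gt0 b_meas b_ge b_le).
have Ege p : G p -> lambda * ip (lebTd d) p.1 p.1 + m * \sum_(i < d) ip (xW W i) (p.2 i) (p.2 i) <= E p p.
  exact: (@energy_ge R d W A lambda b m M m_gt0 b_meas b_ge b_le).
pose lift u := (u, fun i => partialH W A i u).
have liftG u : H1W W A u -> G (lift u) by exact: H1W_W_graph.
(* [a] and [b] agree on the cube, whose complement is null for each [xW W i], so the energy with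
   coefficient [b] is the weak form. *)
have weakE f u : weak_solution W A lambda a f u <->
    H1W W A u /\ forall v, H1W W A v -> E (lift u) (lift v) = ip (lebTd d) f v.
  have EE v w : E (lift v) (lift w) = lambda * \int[lebTd d]_x (v x * w x) +
      \sum_(i < d) \int[xW W i]_x (a i x * partialH W A i v x * partialH W A i w x).
    congr (_ + _); apply/esym; apply: eq_bigr => i _; apply: ae_eq_Rintegral.
    by have := abE i; apply: filterS => x -> _.
  by split=> -[uH uE]; split=> [//|v vH]; [rewrite EE|rewrite -EE]; exact: uE.
(* Both [C * lambda] and [C * m] are at least 1, so [C] times the energy dominates the squared
   Sobolev norm. *)
pose C := Num.max lambda^-1 m^-1.
have C_gt0 : 0 < C by rewrite lt_max !invr_gt0 lambda_gt0.
exists C => // f fL.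
have [p pG pE] : exists2 p, G p & forall q, G q -> E p q = ip (lebTd d) f q.1.
  exact: (energy_riesz W_incr W_per A_eigen lambda_gt0 m_gt0 b_meas b_ge b_le fL).
pose u := p.1; exists u.
have uH : H1W W A u.
  by apply: (W_graph_H1W W_incr W_per A_eigen (G := p.2)); rewrite /u -surjective_pairing.
(* The components of [p] and the chosen [partialH] agree only almost everywhere; the energy does not
   see the difference. *)
have E_ae q q' r : q.1 = q'.1 -> (forall i, q.2 i = q'.2 i %[ae xW W i]) -> E q r = E q' r.
  move=> q1 q2; rewrite /E /energy q1; congr (_ + _); apply: eq_bigr => i _.
  by apply: ae_eq_Rintegral; have := q2 i; apply: filterS => x /(_ I) -> _.
have E_lift q r : G q -> E (lift q.1) r = E q r.
  move=> [qL qG]; apply: E_ae => // i; have [qK qw] := qG i.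
  apply: (partialH_unique W_incr W_per A_eigen _ qK qw).
  apply: (W_graph_H1W W_incr W_per A_eigen (G := q.2)).
  by rewrite -surjective_pairing.
have E_liftr q r : G q -> G r -> E q (lift r.1) = E q r.
  move=> qG rG; have rH : H1W W A r.1.
    by apply: (W_graph_H1W W_incr W_per A_eigen (G := r.2)); rewrite -surjective_pairing.
  by rewrite (sh_sym EH qG (liftG _ rH)) (E_lift _ _ rG) (sh_sym EH rG qG).
have u_sol : weak_solution W A lambda a f u.
  apply/weakE; split=> [//|v vH].
  by rewrite (E_lift _ _ pG) (pE _ (liftG v vH)).
have u_ae i : partialH W A i u = p.2 i %[ae xW W i].
  have [_ pGi] := pG; have [qK qw] := pGi i.
  exact: (partialH_unique W_incr W_per A_eigen _ qK qw).
have [uL _] := pG.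
pose X := ip (lebTd d) u u; pose Y := \sum_(i < d) ip (xW W i) (p.2 i) (p.2 i).
pose F := ip (lebTd d) f f; pose s := Num.sqrt X; pose t := Num.sqrt F.
have X0 : 0 <= X by exact: ip_ge0.
have F0 : 0 <= F by exact: ip_ge0.
have t0 : 0 <= t by exact: sqrtr_ge0.
have Y0 : 0 <= Y by apply: sumr_ge0 => i _; exact: ip_ge0.
(* The equation tested with [p] itself, then Cauchy-Schwarz; both bounds follow from this
   inequality. *)
have XYts : lambda * X + m * Y <= t * s.
  apply: (le_trans (Ege _ pG)); rewrite pE// -sqrtrM//.
  apply: le_trans (ler_norm _) _; rewrite -sqrtr_sqr ler_wsqrtr//.
  exact: (sh_cauchy_schwarz (L2_semi_hilbert (lebTd d)) fL uL).
have sle : s <= lambda^-1 * t.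
  have [s0|sn0] := eqVneq s 0.
    by rewrite s0 mulr_ge0 ?sqrtr_ge0// invr_ge0 ltW.
  have sp : 0 < s by rewrite lt_neqAle eq_sym sn0 sqrtr_ge0.
  rewrite mulrC ler_pdivlMr// -(ler_pM2r sp) mulrAC -expr2 sqr_sqrtr// [X * _]mulrC.
  by apply: le_trans XYts; rewrite lerDl mulr_ge0// ltW.
split => //.
- move=> u' /weakE[u'H u'E].
  have u'G := liftG _ u'H.
  (* The second component of [D] need not be [partialH] of the first; [E_liftr] still allows the
     equation for [u'] to be tested with [D], and both equations then contribute the same <f,
     D.1>. *)
  pose D := lift u' - p; have DG : G D := shB EH u'G pG.
  have DE : D = (-1) *: p + lift u' by rewrite scaleN1r addrC.
  have ED : E D D = 0.
    have DH : H1W W A D.1.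
      by apply: (W_graph_H1W W_incr W_per A_eigen (G := D.2)); rewrite -surjective_pairing.
    rewrite {1}DE (sh_lin EH (-1) pG u'G DG) (pE D DG) -(E_liftr _ _ u'G DG) (u'E _ DH).
    by rewrite mulN1r addNr.
  have D0 : ip (lebTd d) (u' - u) (u' - u) = 0.
    have := Ege _ DG; rewrite ED => le0.
    have I0 : 0 <= ip (lebTd d) (u' - u) (u' - u) by exact: ip_ge0.
    apply/eqP; rewrite eq_le I0 andbT -(pmulr_rle0 _ lambda_gt0).
    apply: le_trans le0; rewrite lerDl mulr_ge0 ?(ltW m_gt0)//.
    by apply: sumr_ge0 => i _; exact: ip_ge0.
  have := ip_eq0_ae DG.1 D0; apply: filterS => x /(_ I) h _.
  by apply/eqP; rewrite -subr_eq0; apply/eqP.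
- rewrite Lfun2_Lnorm//= -/(ip _ f f) -/F -/t /norm1W.
  have -> : inner1W W A u u = X + Y.
    congr (_ + _); apply: eq_bigr => i _; apply: ae_eq_Rintegral.
    by have := u_ae i; apply: filterS => x /(_ I) ->.
  rewrite -(@ler_pXn2r _ 2) ?nnegrE ?mulr_ge0 ?(ltW C_gt0)//.
  rewrite sqr_sqrtr ?addr_ge0// exprMn.
  (* The chain is X + Y <= C (lambda X + m Y) <= C t s <= C^2 t^2, the last step by
     [s <= lambda^-1 * t] and [lambda^-1 <= C]. *)
  apply: (@le_trans _ _ (C * (t * s))); last first.
    rewrite expr2 -mulrA ler_pM2l// expr2 mulrCA.
    rewrite ler_wpM2l ?sqrtr_ge0//.
    by apply: (le_trans sle); rewrite ler_wpM2r ?sqrtr_ge0// le_max lexx.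
  apply: (le_trans _ (ler_wpM2l (ltW C_gt0) XYts)).
  rewrite mulrDr lerD// mulrA ler_peMl//.
    by rewrite -ler_pdivrMr// mul1r le_max lexx.
  by rewrite -ler_pdivrMr// mul1r le_max lexx orbT.
- by rewrite (Lfun2_Lnorm uL) (Lfun2_Lnorm fL).
Qed.
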